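(* Let $Q$ be a convex $(n+3)$-gon in $\mathbb R^2$. Then the secondary polytope $\mathrm{GKZ}_n(Q)=\Sigma(Q)$ has no parallel facets for $n\ge2$.
   Context: Let $Q\subset\mathbb R^2$ be a convex polygon with vertices $q_1,\dots,q_{n+3}$. The GKZ vector of a triangulation $t$ of $Q$ (without new vertices) is $$v(t)=\sum_{i=1}^{n+3}\ \sum_{\sigma\in t\,:\,q_i\in\sigma}\operatorname{vol}(\sigma)\,e_i\in\mathbb R^{n+3},$$ where the inner sum is over the triangles $\sigma$ of $t$ having $q_i$ as a vertex and $\operatorname{vol}$ is the area. The secondary polytope of $Q$ is $\Sigma(Q)=\operatorname{conv}\{v(t): t\text{ a triangulation of }Q\}$; it is an $n$-dimensional polytope in $\mathbb R^{n+3}$. Two distinct facets of a polytope are parallel if their affine hulls are parallel. *)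

(* Defs.v *)
From HB Require Import structures.
From mathcomp Require Import all_boot all_order all_algebra.
From mathcomp Require Import all_classical all_reals.

Set Implicit Arguments.
Unset Strict Implicit.
Unset Printing Implicit Defensive.

Import Order.TTheory GRing.Theory Num.Theory.
Local Open Scope classical_set_scope.
Local Open Scope ring_scope.

Definition convex_hull (R : realType) (m : nat) (A : set 'rV[R]_m) :
    set 'rV[R]_m :=
  [set x | exists (k : nat) (p : 'I_k -> 'rV[R]_m) (l : 'I_k -> R),
     [/\ forall i, A (p i), forall i, 0 <= l i,
         \sum_(i < k) l i = 1 & x = \sum_(i < k) l i *: p i]].

Definition affine_hull (R : realType) (m : nat) (A : set 'rV[R]_m) :
    set 'rV[R]_m :=
  [set x | exists (k : nat) (p : 'I_k -> 'rV[R]_m) (l : 'I_k -> R),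
     [/\ forall i, A (p i),
         \sum_(i < k) l i = 1 & x = \sum_(i < k) l i *: p i]].

(* The affine hull of A is a translate of the row space of a d x m matrix of
   rank d. The empty set has no dimension in this sense, so that a facet, below,
   is nonempty and its polytope has dimension at least 1. *)
Definition has_dim (R : realType) (m : nat) (A : set 'rV[R]_m) (d : nat) :
    Prop :=
  exists (x : 'rV[R]_m) (B : 'M[R]_(d, m)),
    row_free B /\ affine_hull A = [set x + u *m B | u in [set: 'rV[R]_d]].

Definition face (R : realType) (m : nat) (P F : set 'rV[R]_m) : Prop :=
  exists (c : 'cV[R]_m) (b : R),
    (forall x, P x -> (x *m c) 0 0 <= b) /\
    F = [set x | P x /\ (x *m c) 0 0 = b].

Definition facet (R : realType) (m : nat) (P F : set 'rV[R]_m) : Prop :=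
  face P F /\ exists d : nat, has_dim P d.+1 /\ has_dim F d.

(* Used only for affine subspaces of the same dimension. *)
Definition parallel (R : realType) (m : nat) (A B : set 'rV[R]_m) : Prop :=
  exists w : 'rV[R]_m, B = [set x + w | x in A].

Definition parallel_facets (R : realType) (m : nat) (P F G : set 'rV[R]_m) :
    Prop :=
  [/\ facet P F, facet P G, F <> G & parallel (affine_hull F) (affine_hull G)].

(* The points q_i are the N distinct vertices of their convex hull; they need
   not be listed in cyclic order. *)
Definition convex_gon (R : realType) (N : nat) (q : 'I_N -> 'rV[R]_2) : Prop :=
  forall i, ~ convex_hull [set q j | j in [set j | j != i]] (q i).

Definition polygon (R : realType) (N : nat) (q : 'I_N -> 'rV[R]_2) :
    set 'rV[R]_2 := convex_hull (range q).

(* A triangle is encoded by the set of indices of its three vertices. *)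
Definition simplex (R : realType) (N : nat) (q : 'I_N -> 'rV[R]_2)
    (s : {set 'I_N}) : set 'rV[R]_2 :=
  convex_hull [set q i | i in [set` s]].

(* The last condition says that two triangles meet in a common face, which may
   be empty. *)
Definition triangulation (R : realType) (N : nat) (q : 'I_N -> 'rV[R]_2)
    (t : {set {set 'I_N}}) : Prop :=
  [/\ forall s, s \in t -> #|s| = 3%N,
      \bigcup_(s in [set` t]) simplex q s = polygon q &
      forall s s', s \in t -> s' \in t ->
        simplex q s `&` simplex q s' = simplex q (s :&: s')].

Definition triangle_area (R : realType) (a b c : 'rV[R]_2) : R :=
  `|\det (col_mx (b - a) (c - a) : 'M[R]_2)| / 2.

(* The default value is irrelevant: only sets of three indices occur. *)
Definition vol (R : realType) (N : nat) (q : 'I_N -> 'rV[R]_2)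
    (s : {set 'I_N}) : R :=
  if enum s is [:: i; j; k] then triangle_area (q i) (q j) (q k) else 0.

Definition gkz_vector (R : realType) (N : nat) (q : 'I_N -> 'rV[R]_2)
    (t : {set {set 'I_N}}) : 'rV[R]_N :=
  \sum_(i < N) \sum_(s in t | i \in s) (vol q s *: delta_mx 0 i).

Definition secondary_polytope (R : realType) (N : nat) (q : 'I_N -> 'rV[R]_2) :
    set 'rV[R]_N :=
  convex_hull [set gkz_vector q t | t in triangulation q].

(* Main.v *)
Require Import Defs.
From mathcomp Require Import all_boot all_order all_algebra.
From mathcomp Require Import all_classical all_reals.
From mathcomp Require Import ring lra.

(* Let F be the facet of the secondary polytope where the height function c is
   maximal, and t a triangulation with v(t) in F. Since no flip of t increases
   <v(t), c>, the piecewise linear interpolation of c over t is locally concave,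
   hence concave: the plane through a lifted triangle of t lies above all lifted
   vertices. Unless c is affine, t has an edge ij across which the interpolation
   breaks strictly, and no triangulation in F can cross ij. The height
   f_g = max(g, 0), where g = 0 is the line ij, is affine on each side of ij, so
   <v(.), f_g> is constant on F; as F has codimension one, c equals - nu f_g up to
   functionals that are constant on the polytope, and the flip at ij shows
   nu > 0. If G is parallel to F and G <> F, then G is the facet of a negative
   multiple of c, so that some nu f_g + nu' f_g' with nu, nu' > 0 has a constant
   pairing with the polytope and is therefore affine on the vertices of Q. This is
   impossible with at least five vertices. *)

Set Implicit Arguments.
Unset Strict Implicit.
Unset Printing Implicit Defensive.

Import Order.TTheory GRing.Theory Num.Theory.
Local Open Scope ring_scope.

(** * Orientation of point triples and affine functions on the plane *)

Section Plane.
Variable R : realType.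
Implicit Types (a b c d x y : 'rV[R]_2) (l : 'rV[R]_2 -> R).

(** Twice the signed area of the triangle; for fixed [a] and [b] an affine function that vanishes on
    the line through them. *)
Definition orient a b c : R :=
  (b 0 0 - a 0 0) * (c 0 1 - a 0 1) - (b 0 1 - a 0 1) * (c 0 0 - a 0 0).

Definition affine_fun l :=
  exists u v w : R, forall x, l x = u * x 0 0 + v * x 0 1 + w.

Lemma row2P x y : x 0 0 = y 0 0 -> x 0 1 = y 0 1 -> x = y.
Proof.
move=> h0 h1; apply/rowP => i.
case: (i =P 0) => [->//|i0].
suff -> : i = 1 by [].
by case: i i0 => -[|[|//]] ? i0; apply: val_inj => //=; case: i0; apply: val_inj.
Qed.

Lemma orientC a b c : orient b a c = - orient a b c.
Proof. by rewrite /orient; ring. Qed.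

Lemma orient_rot a b c : orient b c a = orient a b c.
Proof. by rewrite /orient; ring. Qed.

Lemma orient_swap a b c : orient a c b = - orient a b c.
Proof. by rewrite /orient; ring. Qed.

Lemma orient_aac a c : orient a a c = 0.
Proof. by rewrite /orient; ring. Qed.

Lemma orient_aba a b : orient a b a = 0.
Proof. by rewrite /orient; ring. Qed.

Lemma orient_abb a b : orient a b b = 0.
Proof. by rewrite /orient; ring. Qed.

Lemma affine_orient a b : affine_fun (orient a b).
Proof.
exists (a 0 1 - b 0 1), (b 0 0 - a 0 0),
  (a 0 0 * (b 0 1 - a 0 1) - a 0 1 * (b 0 0 - a 0 0)) => x.
by rewrite /orient; ring.
Qed.

Lemma affine_scale r l : affine_fun l -> affine_fun (fun x => r * l x).
Proof.
move=> [u [v [w hl]]]; exists (r * u), (r * v), (r * w) => x.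
by rewrite hl; ring.
Qed.

Lemma affine_add l l' :
  affine_fun l -> affine_fun l' -> affine_fun (fun x => l x + l' x).
Proof.
move=> [u [v [w hl]]] [u' [v' [w' hl']]].
by exists (u + u'), (v + v'), (w + w') => x; rewrite hl hl'; ring.
Qed.

Lemma affine_opp l : affine_fun l -> affine_fun (fun x => - l x).
Proof.
move=> [u [v [w hl]]]; exists (- u), (- v), (- w) => x.
by rewrite hl; ring.
Qed.

Lemma affine_cst r : affine_fun (fun=> r).
Proof. by exists 0, 0, r => x; ring. Qed.

(** The orientations are the coefficients of the affine dependency of four points in the plane, and
    affine functions respect it. *)
Lemma affine_dep l a b c d : affine_fun l ->
  orient a b c * l d =
  orient b c d * l a - orient a c d * l b + orient a b d * l c.
Proof. by move=> [u [v [w hl]]]; rewrite !hl /orient; ring. Qed.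

Lemma affine_sum l (I : finType) (w : I -> R) (p : I -> 'rV[R]_2) :
  affine_fun l -> \sum_i w i = 1 ->
  l (\sum_i w i *: p i) = \sum_i w i * l (p i).
Proof.
move=> [u [v [k hl]]] w1; rewrite hl !summxE.
under [RHS]eq_bigr do rewrite hl !mulrDr.
rewrite !big_split /= -mulr_suml w1 mul1r !mulr_sumr.
by congr (_ + _ + _); apply: eq_bigr => i _; rewrite !mxE mulrCA.
Qed.

Lemma affine_comb2 l a b (r s : R) : affine_fun l -> r + s = 1 ->
  l (r *: a + s *: b) = r * l a + s * l b.
Proof.
move=> [u [v [w lE]]] rs; have -> : r = 1 - s by rewrite -rs addrK.
by rewrite !lE !mxE; ring.
Qed.

(** Barycentric coordinates are ratios of orientations. *)
Lemma affine_interp a b c (r s t : R) : orient a b c != 0 ->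
  exists2 l, affine_fun l & [/\ l a = r, l b = s & l c = t].
Proof.
move=> abc0.
exists (fun x => r / orient a b c * orient b c x
     + s / orient a b c * orient c a x + t / orient a b c * orient a b x).
  by do !apply: affine_add; apply/affine_scale/affine_orient.
split; rewrite ?(orient_aac, orient_aba, orient_abb) !mulr0 ?add0r ?addr0.
- by rewrite (orient_rot a b c) divfK.
- by rewrite -(orient_rot c a b) divfK.
- by rewrite divfK.
Qed.

Lemma affine_eq0 l a b c : affine_fun l -> orient a b c != 0 ->
  l a = 0 -> l b = 0 -> l c = 0 -> forall x, l x = 0.
Proof.
move=> hl abc0 la lb lc x; have := affine_dep a b c x hl.
by rewrite la lb lc !mulr0 subr0 addr0 => /eqP; rewrite mulf_eq0 (negPf abc0) => /eqP.
Qed.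

Lemma affine_line l a b c x : affine_fun l -> l a = 0 -> l b = 0 ->
  orient a b c * l x = orient a b x * l c.
Proof.
by move=> hl la lb; rewrite (affine_dep a b c x hl) la lb !mulr0 subr0 add0r.
Qed.

End Plane.

(** * Three-element sets *)

Section Triple.
Variable T : finType.
Implicit Types a b c : T.

Lemma set3C a b c : [set a; b; c] = [set b; a; c].
Proof. by rewrite [[set a; b]]finset.setUC. Qed.

Lemma set3r a b c : [set a; b; c] = [set b; c; a].
Proof. by rewrite -finset.setUA finset.setUC. Qed.

Lemma set3s a b c : [set a; b; c] = [set a; c; b].
Proof. by rewrite -finset.setUA [X in _ :|: X]finset.setUC finset.setUA. Qed.

Lemma cards3 a b c : a != b -> a != c -> b != c -> #|[set a; b; c]| = 3%N.
Proof.
move=> ab ac bc; rewrite finset.setUC cardsU1 cards2 ab !inE.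
by rewrite !(eq_sym c) (negPf ac) (negPf bc).
Qed.

Lemma cards3P (s : {set T}) : #|s| = 3%N ->
  exists a b c, [/\ s = [set a; b; c], a != b, a != c & b != c].
Proof.
move=> s3; have /card_gt0P[a as_] : (0 < #|s|)%N by rewrite s3.
move: (s3); rewrite (cardsD1 a) as_ add1n => -[s2].
have /card_gt0P[b] : (0 < #|s :\ a|)%N by rewrite s2.
rewrite !inE => /andP[ba bs].
move: s2; rewrite (cardsD1 b) !inE ba bs add1n => -[/eqP/cards1P[c sc]].
have : c \in s :\ a :\ b by rewrite sc set11.
rewrite !inE => /and3P[cb ca cs]; exists a, b, c; split; rewrite 1?eq_sym //.
apply/setP => z; move/setP/(_ z): sc; rewrite !inE.
by case: (eqVneq z a) => [->|_] //=; case: (eqVneq z b) => [->|_] //=.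
Qed.

Lemma cards3_sub (s : {set T}) a b : #|s| = 3%N -> a \in s -> b \in s -> a != b ->
  exists c, [/\ s = [set a; b; c], a != c & b != c].
Proof.
move=> s3 as_ bs ab; have /cards1P[c sc] : #|s :\ a :\ b| == 1%N.
  by move: s3; rewrite (cardsD1 a) as_ (cardsD1 b) !inE eq_sym ab bs !add1n => -[->].
have : c \in s :\ a :\ b by rewrite sc set11.
rewrite !inE => /and3P[cb ca cs]; exists c; split; rewrite 1?eq_sym //.
apply/setP => z; move/setP/(_ z): sc; rewrite !inE.
by case: (eqVneq z a) => [->|_] //=; case: (eqVneq z b) => [->|_] //=.
Qed.

Lemma sum_set3 (V : nmodType) (F : T -> V) a b c :
  a != b -> a != c -> b != c ->
  \sum_(i in [set a; b; c]) F i = F a + F b + F c.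
Proof.
move=> ab ac bc; rewrite finset.setUC big_setU1 /= ?inE ?negb_or ?(eq_sym c) ?ac ?bc //.
by rewrite big_setU1 /= ?inE // big_set1 addrC.
Qed.

Lemma sum_supp3 (V : nmodType) (F : T -> V) a b c :
  a != b -> a != c -> b != c ->
  (forall i, i \notin [set a; b; c] -> F i = 0) ->
  \sum_i F i = F a + F b + F c.
Proof.
move=> ab ac bc F0; rewrite -sum_set3 // (bigID (mem [set a; b; c])) /=.
by rewrite [X in _ + X]big1 ?addr0.
Qed.

End Triple.

(** * Convex combinations indexed by the vertices *)

Section Simplex.
Variables (R : realType) (N : nat) (q : 'I_N -> 'rV[R]_2).
Implicit Types (A B : {set 'I_N}) (i j k m : 'I_N) (x : 'rV[R]_2).

(** The weights are indexed by all vertices and vanish outside [A], so that combinations over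
    different faces can be compared directly. *)
Definition weights A x (w : 'I_N -> R) :=
  [/\ forall i, 0 <= w i, forall i, i \notin A -> w i = 0,
      \sum_i w i = 1 & x = \sum_i w i *: q i].

Lemma simplexP A x : simplex q A x <-> exists w, weights A x w.
Proof.
split=> [[k [p [r [pA r0 r1 ->]]]]|[w [w0 wA w1 ->]]].
  have /boolp.choice[f fP] : forall m : 'I_k, exists i, i \in A /\ q i = p m.
    by move=> m; have [i iA ip] := pA m; exists i.
  exists (fun i => \sum_(m : 'I_k | f m == i) r m); split.
  - by move=> i; apply: sumr_ge0.
  - move=> i iA; apply: big1 => m /eqP fm.
    by move: iA; rewrite -fm (fP m).1.
  - by rewrite -r1 [RHS](partition_big f predT).
  - rewrite [LHS](partition_big f predT) //=; apply: eq_bigr => i _.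
    by rewrite scaler_suml; apply: eq_bigr => m /eqP <-; rewrite (fP m).2.
(* In [convex_hull] every listed point must belong to the set: an index outside [A] is given the
   point of some [i0] in [A], with weight zero. *)
have [i0 i0A] : exists i0, i0 \in A.
  apply: contrapT => hA; move: w1; rewrite big1 => [/esym/eqP|i _].
    by rewrite oner_eq0.
  by apply: wA; apply/negP => iA; apply: hA; exists i.
exists N, (fun i => q (if i \in A then i else i0)), w; split=> //.
  by move=> i; exists (if i \in A then i else i0) => //=; case: ifP.
by apply: eq_bigr => i _; case: ifPn => // /wA ->; rewrite !scale0r.
Qed.

Lemma polygonE : polygon q = simplex q [set: 'I_N].
Proof.
rewrite /polygon /simplex; congr convex_hull.
by apply/seteqP; split=> x /= [i _ <-]; exists i => //=; rewrite inE.
Qed.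

Lemma simplexS A B x : A \subset B -> simplex q A x -> simplex q B x.
Proof.
move=> AB /simplexP[w [w0 wA w1 xE]]; apply/simplexP; exists w; split=> // i iB.
by apply: wA; apply: contra iB; apply: fintype.subsetP.
Qed.

Lemma simplex_comb3 A i j k (u v w : R) : i \in A -> j \in A -> k \in A ->
  0 <= u -> 0 <= v -> 0 <= w -> u + v + w = 1 ->
  simplex q A (u *: q i + v *: q j + w *: q k).
Proof.
move=> iA jA kA u0 v0 w0 uvw.
exists 3%N, (fun m : 'I_3 => [:: q i; q j; q k]`_m),
  (fun m : 'I_3 => [:: u; v; w]`_m); split.
- by case=> -[|[|[|//]]] ? /=; [exists i|exists j|exists k].
- by case=> -[|[|[|//]]] ?.
- by rewrite !big_ord_recr big_ord0 /= add0r.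
- by rewrite !big_ord_recr big_ord0 /= add0r.
Qed.

Lemma weights_affine A x w (l : 'rV[R]_2 -> R) : weights A x w ->
  affine_fun l -> l x = \sum_(i in A) w i * l (q i).
Proof.
move=> [w0 wA w1 ->] hl; rewrite affine_sum // [LHS](bigID (mem A)) /=.
by rewrite [X in _ + X]big1 ?addr0 // => i /wA ->; rewrite mul0r.
Qed.

End Simplex.

(** * Convex position: no three vertices are collinear *)

Section ConvexPosition.
Variables (R : realType) (N : nat) (q : 'I_N -> 'rV[R]_2).
Hypothesis hq : convex_gon q.
Implicit Types (A B : {set 'I_N}) (i j k m a b c d : 'I_N) (x : 'rV[R]_2).
Local Notation D i j k := (orient (q i) (q j) (q k)).

(** The indices [a], [b], [c] may coincide and the coefficients are not normalised, so that this
    also covers a vertex on a segment or equal to another vertex. *)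
Lemma gon_vertex a b c d (u v w : R) : a != d -> b != d -> c != d ->
  0 <= u -> 0 <= v -> 0 <= w -> 0 < u + v + w ->
  u *: q a + v *: q b + w *: q c = (u + v + w) *: q d -> False.
Proof.
move=> ad bd cd u0 v0 w0 s0 e; apply: (hq (i := d)).
have -> : q d = (u / (u + v + w)) *: q a + (v / (u + v + w)) *: q b
    + (w / (u + v + w)) *: q c.
  apply: (scalerI (lt0r_neq0 s0)); rewrite -e !scalerDr !scalerA.
  by rewrite ![(u + v + w) * _]mulrC !divfK ?lt0r_neq0.
have -> : [set q j | j in [set j | j != d]]%classic =
    [set q j | j in [set` ~: [set d]]]%classic.
  by apply/seteqP; split=> x /= [j jd <-]; exists j => //=; move: jd; rewrite !inE.
apply: simplex_comb3; rewrite ?inE ?divr_ge0 ?(ltW s0) //.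
by rewrite -!mulrDl divff // lt0r_neq0.
Qed.

Lemma orient_neq0 a b c : a != b -> a != c -> b != c -> D a b c != 0.
Proof.
move=> ab ac bc; apply/eqP => D0.
have [e|/eqP qab] := eqVneq (q a) (q b).
  apply: (@gon_vertex a a a b 1 0 0); rewrite ?ler01 ?lexx ?addr0 ?ltr01 //.
  by rewrite !scale0r !addr0 e.
have [s sE] : exists s, q c = (1 - s) *: q a + s *: q b.
  have [e|x0] := eqVneq (q b 0 0) (q a 0 0).
    have y0 : q b 0 1 - q a 0 1 != 0.
      by rewrite subr_eq0; apply: contra_notN qab => /eqP h; apply: row2P.
    exists ((q c 0 1 - q a 0 1) / (q b 0 1 - q a 0 1)).
    apply: row2P; rewrite !mxE; last by field.
    move/eqP: D0; rewrite /orient e subrr mul0r sub0r oppr_eq0 mulf_eq0 (negPf y0).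
    by rewrite subr_eq0 => /eqP ->; ring.
  have x1 : q b 0 0 - q a 0 0 != 0 by rewrite subr_eq0.
  exists ((q c 0 0 - q a 0 0) / (q b 0 0 - q a 0 0)).
  apply: row2P; rewrite !mxE; first by field.
  apply: (mulfI x1); move/eqP: D0; rewrite /orient subr_eq0 => /eqP D0.
  apply: (addIr (- ((q b 0 0 - q a 0 0) * q a 0 1))); rewrite -mulrBr D0.
  by field.
(* The position [s] of [q c] on the line tells which point lies between the other two: [a], [c] or
   [b], in this order of cases. *)
have [s0|s0] := ltP s 0; [|have [s1|s1] := leP s 1].
{ apply: (@gon_vertex b c c a (- s) 1 0);
    last by rewrite sE; apply: row2P; rewrite !mxE; ring.
  all: rewrite 1?eq_sym //; lra. }
{ apply: (@gon_vertex a b b c (1 - s) s 0);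
    last by rewrite sE; apply: row2P; rewrite !mxE; ring.
  all: rewrite //; lra. }
apply: (@gon_vertex a c c b (s - 1) 1 0);
  last by rewrite sE; apply: row2P; rewrite !mxE; ring.
all: rewrite 1?[c == b]eq_sym //; lra.
Qed.

End ConvexPosition.

(** * Orientations of four points in convex position *)

Section Orientation.
Variables (R : realType) (N : nat) (q : 'I_N -> 'rV[R]_2).
Hypothesis hq : convex_gon q.
Implicit Types (A B : {set 'I_N}) (i j k m a b c d : 'I_N) (x : 'rV[R]_2).
Local Notation D i j k := (orient (q i) (q j) (q k)).

Definition ccw a b c := 0 < D a b c.

Lemma ccw_rot a b c : ccw b c a = ccw a b c.
Proof. by rewrite /ccw orient_rot. Qed.

Lemma ccwN a b c : a != b -> a != c -> b != c -> ~~ ccw a b c -> D a b c < 0.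
Proof.
move=> ab ac bc; rewrite /ccw -leNgt le_eqVlt.
by rewrite (negPf (orient_neq0 hq ab ac bc)).
Qed.

Lemma gon_dep a b c d (u v w t : R) : a != d -> b != d -> c != d ->
  u + v + w + t = 0 -> u *: q a + v *: q b + w *: q c + t *: q d = 0 ->
  0 <= u -> 0 <= v -> 0 <= w -> t < 0 -> False.
Proof.
move=> ad bd cd s0 e u0 v0 w0 t0; apply: (gon_vertex hq ad bd cd u0 v0 w0).
  by move: t0; rewrite -(addr0_eq s0) oppr_lt0.
have -> : u + v + w = - t by rewrite -(addr0_eq s0) opprK.
by rewrite scaleNr -(addr0_eq e) opprK.
Qed.

(* Radon: four points in convex position have an affine dependency with two
   coefficients of each sign. *)
Lemma ccw4 a b c d : a != b -> a != c -> a != d -> b != c -> b != d -> c != d ->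
  ccw b c d (+) ccw a c d (+) ccw a b d (+) ccw a b c = false.
Proof.
move=> ab ac ad bc bd cd.
have s0 : D b c d - D a c d + D a b d - D a b c = 0 by rewrite /orient; ring.
have eq1 : (D b c d) *: q a + (- D a c d) *: q b
    + (D a b d) *: q c + (- D a b c) *: q d = 0.
  by apply: row2P; rewrite !mxE /orient; ring.
have eq2 : (- D b c d) *: q a + (D a c d) *: q b
    + (- D a b d) *: q c + (D a b c) *: q d = 0.
  by apply: row2P; rewrite !mxE /orient; ring.
(* Odd parity leaves one coefficient with a sign of its own. The rotations in [P] bring it to the
   last place, and the negated dependency [eq2] serves when it is positive. *)
have P (p1 p2 p3 p4 : 'rV[R]_2) : p1 + p2 + p3 + p4 = 0 ->
  [/\ p2 + p3 + p4 + p1 = 0, p3 + p4 + p1 + p2 = 0 & p4 + p1 + p2 + p3 = 0].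
  by move=> <-; split; apply: row2P; rewrite !mxE; ring.
have [eq1a eq1b eq1c] := P _ _ _ _ eq1.
have [eq2a eq2b eq2c] := P _ _ _ _ eq2.
rewrite /ccw; case: (ltP 0 (D b c d)) => h1; case: (ltP 0 (D a c d)) => h2;
case: (ltP 0 (D a b d)) => h3; case: (ltP 0 (D a b c)) => h4 //=; exfalso.
all: have n1 := orient_neq0 hq bc bd cd; have n2 := orient_neq0 hq ac ad cd.
all: have n3 := orient_neq0 hq ab ad bd; have n4 := orient_neq0 hq ab ac bc.
all: rewrite ?[D b c d <= 0]le_eqVlt ?(negPf n1) ?[D a c d <= 0]le_eqVlt ?(negPf n2)
  ?[D a b d <= 0]le_eqVlt ?(negPf n3) ?[D a b c <= 0]le_eqVlt ?(negPf n4) /= in h1 h2 h3 h4.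
all: [> apply: (gon_dep _ _ _ _ eq1b)
 | apply: (gon_dep _ _ _ _ eq2a)
 | apply: (gon_dep _ _ _ _ eq1)
 | apply: (gon_dep _ _ _ _ eq1c)
 | apply: (gon_dep _ _ _ _ eq2c)
 | apply: (gon_dep _ _ _ _ eq2)
 | apply: (gon_dep _ _ _ _ eq1a)
 | apply: (gon_dep _ _ _ _ eq2b)].
all: rewrite ?oppr_ge0 ?oppr_lt0 ?(ltW h1) ?(ltW h2) ?(ltW h3) ?(ltW h4) // 1?eq_sym //.
all: first [by apply: etrans s0; ring
  | by apply: oppr_inj; rewrite oppr0; apply: etrans s0; ring].
Qed.

Lemma ccw_cross i j a b : i != j -> i != a -> i != b -> j != a -> j != b -> a != b ->
  (ccw i j a != ccw i j b) = (ccw a b i != ccw a b j).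
Proof.
move=> ij ia ib ja jb ab; have := ccw4 ij ia ib ja jb ab.
by rewrite (ccw_rot i a b) (ccw_rot j a b); do 4!case: ccw.
Qed.

End Orientation.

(** * Edges of a triangulation *)

Section Triangulation.
Variables (R : realType) (N : nat) (q : 'I_N -> 'rV[R]_2).
Hypothesis hq : convex_gon q.
Implicit Types (A B s u : {set 'I_N}) (i j k m a b c d p : 'I_N) (x : 'rV[R]_2).
Implicit Types t : {set {set 'I_N}}.
Local Notation D i j k := (orient (q i) (q j) (q k)).

Lemma orient_neq i j a : D i j a != 0 -> [/\ i != j, i != a & j != a].
Proof.
by move=> h; split; apply: contra_neq h => ->; rewrite ?(orient_aac, orient_aba, orient_abb).
Qed.

Lemma simplex3P a b c x : a != b -> a != c -> b != c ->
  simplex q [set a; b; c] x <->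
  [/\ 0 <= D a b c * orient (q a) (q b) x, 0 <= D a b c * orient (q b) (q c) x
    & 0 <= D a b c * orient (q c) (q a) x].
Proof.
move=> ab ac bc; have D0 := orient_neq0 hq ab ac bc.
have D2 : 0 < D a b c * D a b c by rewrite -expr2 exprn_even_gt0.
split=> [/simplexP[w xw]|[h1 h2 h3]].
  have [w0 _ _ _] := xw.
  rewrite !(weights_affine xw (affine_orient _ _)) !sum_set3 //.
  rewrite !(orient_aac, orient_aba, orient_abb) !mulr0 !add0r !addr0.
  rewrite (orient_rot (q a) (q b) (q c)) -(orient_rot (q c) (q a) (q b)).
  by split; rewrite mulrCA mulr_ge0 // ltW.
have -> : x = (orient (q b) (q c) x / D a b c) *: q a
  + (orient (q c) (q a) x / D a b c) *: q b + (orient (q a) (q b) x / D a b c) *: q c.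
  by move: D0; rewrite /orient => D0; apply: row2P; rewrite !mxE; field.
have pos r : 0 <= D a b c * r -> 0 <= r / D a b c.
  move=> h; have -> : r / D a b c = D a b c * r / (D a b c * D a b c) by field.
  by rewrite divr_ge0 // ltW.
apply: simplex_comb3; rewrite ?inE ?eqxx ?orbT ?pos //.
by move: D0; rewrite /orient => D0; field.
Qed.

(** No triangle has vertices strictly on both sides of the line [l = 0]; vertices on the line are
    allowed. *)
Definition one_sided t (l : 'rV[R]_2 -> R) := forall u a b,
  u \in t -> a \in u -> b \in u -> 0 < l (q a) -> 0 <= l (q b).

Definition uncrossed t i j := one_sided t (orient (q i) (q j)).

Lemma uncrossedC t i j : uncrossed t i j -> uncrossed t j i.
Proof.
move=> h u a b ut au bu; rewrite !(orientC (q i)) oppr_gt0 oppr_ge0 => la.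
by rewrite leNgt; apply/negP => lb; have := h u b a ut bu au lb; rewrite leNgt la.
Qed.

Lemma opposite_sides i j a b : D i j a < 0 -> 0 < D i j b ->
  0 < D a b i /\ D a b j < 0.
Proof.
move=> ha hb.
have [ij ia ja] := orient_neq (ltr0_neq0 ha).
have [_ ib jb] := orient_neq (lt0r_neq0 hb).
have ab : a != b by apply: contraTneq hb => <-; rewrite -leNgt ltW.
have WE : D a b i - D a b j = D i j b - D i j a by rewrite /orient; ring.
have := ccw_cross hq ij ia ib ja jb ab.
rewrite [ccw q i j b]/ccw hb [ccw q i j a]/ccw ltNge (ltW ha) /= => /esym.
have Dj0 : D a b j != 0 by apply: orient_neq0; rewrite // eq_sym.
rewrite /ccw; case: (ltP 0 (D a b i)) => hi; case: (ltP 0 (D a b j)) => hj //= _.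
  by split=> //; rewrite lt_neqAle Dj0.
by lra.
Qed.

(** The diagonals of a convex quadrilateral meet; the four weights are ratios of orientations with
    the common denominator [D i j b - D i j a]. *)
Lemma crossing i j a b : D i j a < 0 -> 0 < D i j b ->
  exists x y z w : R, [/\ [/\ 0 < x, 0 < y, 0 < z & 0 < w],
    x + y = 1, z + w = 1 & x *: q i + y *: q j = z *: q a + w *: q b].
Proof.
move=> ha hb; have [hi hj] := opposite_sides ha hb.
have W0 : 0 < D i j b - D i j a by rewrite subr_gt0 (lt_trans ha).
have WE : D a b i - D a b j = D i j b - D i j a by rewrite /orient; ring.
exists (- D a b j / (D i j b - D i j a)), (D a b i / (D i j b - D i j a)),
  (D i j b / (D i j b - D i j a)), (- D i j a / (D i j b - D i j a)); split.
- by rewrite !divr_gt0 // oppr_gt0.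
- by rewrite -mulrDl addrC WE divff // lt0r_neq0.
- by rewrite -mulrDl divff // lt0r_neq0.
- apply: (scalerI (lt0r_neq0 W0)); rewrite !scalerDr !scalerA.
  rewrite ![(D i j b - D i j a) * _]mulrC !divfK ?lt0r_neq0 //.
  by apply: row2P; rewrite !mxE /orient; ring.
Qed.

(** With [k] the third vertex of [s], [orient (q j) (q k)] vanishes on every face omitting [i], yet
    it is [x * D j k i] at the given point. *)
Lemma simplex_edge_mem s A i j (x y : R) : #|s| = 3%N -> i \in s -> j \in s ->
  i != j -> x != 0 -> A \subset s -> simplex q A (x *: q i + y *: q j) ->
  x + y = 1 -> i \in A.
Proof.
move=> s3 is_ js ij x0 As /simplexP[w xw] xy; have [k [sE ik jk]] := cards3_sub s3 is_ js ij.
apply: contraNT x0 => iA.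
have := weights_affine xw (affine_orient (q j) (q k)).
have -> : orient (q j) (q k) (x *: q i + y *: q j) = x * D j k i.
  have -> : y = 1 - x by rewrite -xy addrC addKr.
  by rewrite /orient !mxE; ring.
rewrite big1 => [/eqP|a aA].
  by rewrite mulf_eq0 (negPf (orient_neq0 hq jk _ _)) ?orbF // eq_sym.
have := fintype.subsetP As _ aA; rewrite sE !inE => /orP[/orP[]|] /eqP ae.
- by move: aA; rewrite ae (negPf iA).
- by rewrite ae orient_aba mulr0.
- by rewrite ae orient_abb mulr0.
Qed.

(** A crossing point of [ij] with an edge [ab] of [u] lies in both triangles, hence in their common
    face, which must then contain [a] and [b]; but [s] has only one vertex besides [i] and [j]. *)
Lemma uncrossed_edge t s i j : triangulation q t -> s \in t -> i \in s -> j \in s ->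
  i != j -> uncrossed t i j.
Proof.
move=> [t3 _ tI] st is_ js ij u b a ut bu au hb; rewrite leNgt; apply/negP => ha.
have [x [y [z [w [[x0 y0 z0 w0] xy zw e]]]]] := crossing ha hb.
have ab : a != b by apply: contraTneq hb => <-; rewrite -leNgt ltW.
have xsu : simplex q (s :&: u) (x *: q i + y *: q j).
  rewrite -tI //; split=> /=.
    rewrite -[_ + _]addr0 -[X in _ + X](scale0r (q i)).
    by apply: simplex_comb3; rewrite ?addr0 // ltW.
  rewrite e -[_ + _]addr0 -[X in _ + X](scale0r (q a)).
  by apply: simplex_comb3; rewrite ?addr0 // ltW.
have aS : a \in s :&: u.
  apply: (@simplex_edge_mem u _ a b z w); rewrite -?e ?t3 ?subsetIr //.
  exact: lt0r_neq0.
have bS : b \in s :&: u.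
  apply: (@simplex_edge_mem u _ b a w z); rewrite 1?addrC -?e ?t3 ?subsetIr //.
  - by rewrite eq_sym.
  - exact: lt0r_neq0.
have [k [sE ik jk]] := cards3_sub (t3 _ st) is_ js ij.
have [_ ia ja] := orient_neq (ltr0_neq0 ha).
have [_ ib jb] := orient_neq (lt0r_neq0 hb).
move: aS bS ab; rewrite sE !inE ![_ == i]eq_sym ![_ == j]eq_sym.
rewrite (negPf ia) (negPf ja) (negPf ib) (negPf jb) /=.
by move=> /andP[/eqP -> _] /andP[/eqP -> _]; rewrite eqxx.
Qed.

Lemma eps_finite (T : finType) (P : T -> R -> Prop) :
  (forall z, exists2 e, 0 < e & forall r, 0 < r < e -> P z r) ->
  exists2 e, 0 < e & forall z r, 0 < r < e -> P z r.
Proof.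
move=> h; suff [e e0 he] : exists2 e, 0 < e &
    forall z, z \in enum T -> forall r, 0 < r < e -> P z r.
  by exists e => // z; apply: he; rewrite mem_enum.
elim: (enum T) => [|z zs [e e0 he]]; first by exists 1.
have [e' e'0 he'] := h z.
exists (Num.min e e'); first by rewrite lt_min e0.
move=> y + r; rewrite inE lt_min => yz /and3P[r0 re re'].
by case/orP: yz => [/eqP->|yz]; [apply: he'; rewrite r0|apply: he; rewrite ?r0].
Qed.

Lemma simplex3_nbhs s x y : #|s| = 3%N -> ~ simplex q s x ->
  exists2 e, 0 < e & forall r, 0 < r < e ->
    ~ simplex q s ((1 - r) *: x + r *: y).
Proof.
move=> /cards3P[a [b [c [-> ab ac bc]]]].
have key l : affine_fun l -> ~~ (0 <= l x) -> exists2 e, 0 < e & forall r, 0 < r < e ->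
    l ((1 - r) *: x + r *: y) < 0.
  move=> [u [v [w lE]]]; rewrite -ltNge => lx.
  have z0 : 0 < 1 + `|l y - l x| by rewrite ltr_pwDl.
  (* The increment of [l] is at most [r] times the absolute value of [l y - l x]; the added 1 keeps
     the denominator positive. *)
  exists (- l x / (1 + `|l y - l x|)); first by rewrite divr_gt0 // oppr_gt0.
  move=> r /andP[r0]; rewrite ltr_pdivlMr // => hr.
  have -> : l ((1 - r) *: x + r *: y) = l x + r * (l y - l x).
    by rewrite !lE !mxE; ring.
  have := ler_norm (l y - l x) => hn.
  have : r * (l y - l x) <= r * `|l y - l x| by rewrite ler_wpM2l // ltW.
  by lra.
have aff a' b' : affine_fun (fun x => D a b c * orient (q a') (q b') x).
  exact/affine_scale/affine_orient.
move=> h; have : ~~ [&& 0 <= D a b c * orient (q a) (q b) x,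
    0 <= D a b c * orient (q b) (q c) x & 0 <= D a b c * orient (q c) (q a) x].
  by apply/negP => /and3P h'; apply: h; apply/simplex3P.
rewrite !negb_and => /or3P[] /(key _ (aff _ _))[e e0 he]; exists e => // r /he.
- by rewrite ltNge => /negP H /simplex3P[].
- by rewrite ltNge => /negP H /simplex3P[].
- by rewrite ltNge => /negP H /simplex3P[].
Qed.

(** A point near the midpoint of [ij], on the side of [p], lies in some triangle, which contains the
    midpoint too if the point is near enough. As no triangle crosses the line [ij], the midpoint is
    a combination of [i] and [j] alone, so both are vertices of the triangle. *)
Lemma adjacent t i j p : triangulation q t -> uncrossed t i j -> 0 < D i j p ->
  exists2 m, [set i; j; m] \in t & 0 < D i j m.
Proof.
move=> [t3 tU tI] hu hp.
have [ij ip jp] := orient_neq (lt0r_neq0 hp).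
pose x0 : 'rV[R]_2 := 2^-1 *: q i + 2^-1 *: q j.
have [e e0 he] : exists2 e, 0 < e & forall (u : {set 'I_N}) r, 0 < r < e ->
    u \in t -> simplex q u ((1 - r) *: x0 + r *: q p) -> simplex q u x0.
  apply: eps_finite => u.
  have [ut|] := boolP (u \in t); last by exists 1.
  have [?|nx] := pselect (simplex q u x0); first by exists 1.
  have [e e0 he] := simplex3_nbhs (q p) (t3 _ ut) nx.
  by exists e => // r /he.
pose r := Num.min e 1 / 2.
have r01 : 0 < r < e /\ r < 1.
  rewrite /r; have : 0 < Num.min e 1 by rewrite lt_min e0 ltr01.
  have : Num.min e 1 <= e by rewrite ge_min lexx.
  have : Num.min e 1 <= 1 by rewrite ge_min lexx orbT.
  by move=> *; split; [apply/andP; split|]; lra.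
have [r0e r1] := r01; have /andP[r0 _] := r0e.
pose y := (1 - r) *: x0 + r *: q p.
have yE : y = ((1 - r) / 2) *: q i + ((1 - r) / 2) *: q j + r *: q p.
  by rewrite /y /x0 scalerDr !scalerA.
have : polygon q y.
  rewrite polygonE yE; apply: simplex_comb3; rewrite ?inE //; lra.
rewrite -tU => -[u /= ut yu].
have x0u : simplex q u x0 by apply: he yu.
have hl : affine_fun (orient (q i) (q j)) by exact: affine_orient.
have [w xw] := (simplexP _ _ _).1 x0u; have [w0 wu w1 xE] := xw.
have := weights_affine xw hl.
have -> : orient (q i) (q j) x0 = 0 by rewrite /orient /x0 !mxE; field.
move=> /esym s0.
(* The terms of the vanishing sum [s0] have one sign: either some vertex of [u] is left of [ij], and
   then none is on the right, or none is on the left. *)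
have wz : forall a, a \in u -> w a * D i j a = 0.
  have [[a0 a0u a0p]|hn] := pselect (exists2 a, a \in u & 0 < D i j a).
    apply/psumr_eq0P => // a au; rewrite mulr_ge0 //; exact: hu au a0p.
  move=> a au; apply: oppr_inj; rewrite oppr0; move: a au; apply/psumr_eq0P.
    move=> a au; rewrite -mulrN mulr_ge0 // oppr_ge0 leNgt.
    by apply/negP => h; apply: hn; exists a.
  by rewrite sumrN s0 oppr0.
have wz' a : a != i -> a != j -> w a = 0.
  move=> ai aj; have [au|/wu //] := boolP (a \in u).
  have /eqP := wz a au; rewrite mulf_eq0 => /orP[/eqP //|].
  by rewrite (negPf (orient_neq0 hq ij _ _)) // eq_sym.
have iu : i \in u.
  apply: contraT => /wu wi; have := weights_affine xw (affine_orient (q j) (q p)).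
  rewrite big1 => [|a _].
    have -> : orient (q j) (q p) x0 = 2^-1 * D j p i by rewrite /orient /x0 !mxE; field.
    move/eqP; rewrite mulf_eq0 invr_eq0 pnatr_eq0 /=.
    by rewrite (negPf (orient_neq0 hq jp _ _)) // eq_sym.
  have [->|ai] := eqVneq a i; first by rewrite wi mul0r.
  have [->|aj] := eqVneq a j; first by rewrite orient_aba mulr0.
  by rewrite wz' // mul0r.
have ju : j \in u.
  apply: contraT => /wu wj; have := weights_affine xw (affine_orient (q i) (q p)).
  rewrite big1 => [|a _].
    have -> : orient (q i) (q p) x0 = 2^-1 * D i p j by rewrite /orient /x0 !mxE; field.
    move/eqP; rewrite mulf_eq0 invr_eq0 pnatr_eq0 /=.
    by rewrite (negPf (orient_neq0 hq ip _ _)) // eq_sym.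
  have [->|aj] := eqVneq a j; first by rewrite wj mul0r.
  have [->|ai] := eqVneq a i; first by rewrite orient_aba mulr0.
  by rewrite wz' // mul0r.
have [m [uE im jm]] := cards3_sub (t3 _ ut) iu ju ij.
exists m; rewrite -?uE //.
have [v yv] := (simplexP _ _ _).1 yu; have [v0 _ _ _] := yv.
have := weights_affine yv hl; rewrite {1}uE sum_set3 //.
rewrite orient_aba orient_abb !mulr0 !add0r.
have -> : orient (q i) (q j) y = r * D i j p by rewrite yE /orient !mxE; field.
move=> vm; have : 0 < v m * D i j m by rewrite -vm mulr_gt0.
have := v0 m; rewrite le_eqVlt => /orP[/eqP <-|vm0]; first by rewrite mul0r ltxx.
by rewrite pmulr_rgt0.
Qed.

(** If [m] and [m'] differed, the triangles would meet in a face on the line [ij], but they share a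
    point strictly to the left of it. *)
Lemma adjacent_uniq t i j m m' : triangulation q t ->
  [set i; j; m] \in t -> [set i; j; m'] \in t -> 0 < D i j m -> 0 < D i j m' ->
  m = m'.
Proof.
move=> [t3 _ tI] mt mt' hm hm'; apply/eqP; apply: contraT => mm.
have [ij im jm] := orient_neq (lt0r_neq0 hm).
(* Up to the factor [W], the point [x] has weights [K], [K], [D i j m] over [i], [j], [m']. The
   dependency of the four points rewrites it over [i], [j], [m], and [K] is large enough to keep
   these weights nonnegative. *)
pose K := `|D j m m'| + `|D i m m'|; pose W := 2 * K + D i j m.
have K0 : 0 <= K by rewrite addr_ge0.
have W0 : 0 < W by rewrite /W; lra.
have WE : K + D j m m' + (K - D i m m') + D i j m' = W by rewrite /W /orient; ring.
pose x : 'rV[R]_2 := (K / W) *: q i + (K / W) *: q j + (D i j m / W) *: q m'.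
have xE : x = ((K + D j m m') / W) *: q i + ((K - D i m m') / W) *: q j
    + (D i j m' / W) *: q m.
  apply: (scalerI (lt0r_neq0 W0)); rewrite /x !scalerDr !scalerA.
  rewrite ![W * _]mulrC !divfK ?lt0r_neq0 //.
  by apply: row2P; rewrite !mxE /orient; ring.
have h1 : - `|D j m m'| <= D j m m' by have := ler_norm (- D j m m'); rewrite normrN; lra.
have h2 := ler_norm (D i m m').
have n1 := normr_ge0 (D j m m'); have n2 := normr_ge0 (D i m m').
have : simplex q ([set i; j; m] :&: [set i; j; m']) x.
  rewrite -tI //; split=> /=.
    rewrite xE; apply: simplex_comb3; rewrite ?inE ?eqxx ?orbT // ?divr_ge0 ?(ltW W0) //.
    + by rewrite /K; lra.
    + by rewrite /K; lra.
    + exact: ltW.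
    + by rewrite -!mulrDl WE divff // lt0r_neq0.
  apply: simplex_comb3; rewrite ?inE ?eqxx ?orbT // ?divr_ge0 ?(ltW W0) //.
  + exact: ltW.
  + have -> : K / W + K / W + D i j m / W = W / W by rewrite /W; ring.
    by rewrite divff // lt0r_neq0.
move=> /simplexP[w xw]; have := weights_affine xw (affine_orient (q i) (q j)).
rewrite big1 => [|a]; last first.
  rewrite !inE => /andP[/orP[/orP[]|] /eqP-> hb].
  - by rewrite orient_aba mulr0.
  - by rewrite orient_abb mulr0.
  - by move: hb; rewrite (negPf mm) !(eq_sym m) (negPf im) (negPf jm).
have -> : orient (q i) (q j) x = D i j m * D i j m' / W.
  have W1 := lt0r_neq0 W0; move: W1; rewrite /x /W /orient !mxE => W1; by field.
move/eqP; rewrite !mulf_eq0 invr_eq0 (negPf (lt0r_neq0 W0)).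
by rewrite (negPf (lt0r_neq0 hm)) (negPf (lt0r_neq0 hm')).
Qed.

End Triangulation.

(** * Flips *)

Section Flip.
Variables (R : realType) (N : nat) (q : 'I_N -> 'rV[R]_2).
Hypothesis hq : convex_gon q.
Implicit Types (A B s u : {set 'I_N}) (i j k m a b c d p : 'I_N) (x : 'rV[R]_2).
Implicit Types t : {set {set 'I_N}}.
Local Notation D i j k := (orient (q i) (q j) (q k)).

Definition flip t i j k m :=
  [set m; k; i] |: ([set m; k; j] |: (t :\ [set i; j; k] :\ [set i; j; m])).

(** The diagonal [mk] cuts the triangle [ijk] in two, and the sign of [orient (q m) (q k)] at [x]
    selects the piece. *)
Lemma flip_cover i j k m x : 0 < D i j k -> D i j m < 0 ->
  simplex q [set i; j; k] x ->
  simplex q [set m; k; i] x \/ simplex q [set m; k; j] x.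
Proof.
move=> hk hm; have [hi hj] := opposite_sides hq hm hk.
have [ij ik jk] := orient_neq (lt0r_neq0 hk).
have [mk mi ki] := orient_neq (lt0r_neq0 hi).
have [_ mj kj] := orient_neq (ltr0_neq0 hj).
move=> /simplexP[w xw]; have [w0 _ _ _] := xw.
have ev a b : orient (q a) (q b) x = w i * D a b i + w j * D a b j + w k * D a b k.
  by rewrite (weights_affine xw (affine_orient _ _)) sum_set3.
have [h|h] := leP 0 (orient (q m) (q k) x).
  left; apply/simplex3P => //; split.
  - by rewrite mulr_ge0 // ltW.
  - apply: mulr_ge0; [exact: ltW|rewrite ev orient_abb orient_aba !mulr0 add0r addr0].
    by rewrite mulr_ge0 // -(orient_rot (q k)) ltW.
  - apply: mulr_ge0; [exact: ltW|rewrite ev orient_aba mulr0 add0r].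
    apply: addr_ge0; apply: mulr_ge0 => //.
      by rewrite orient_swap oppr_ge0 ltW.
    by rewrite -(orient_rot (q i)) ltW.
right; apply/simplex3P => //; split.
- by rewrite mulr_le0 // ltW.
- apply: mulr_le0; [exact: ltW|rewrite ev orient_abb orient_aba !mulr0 !addr0].
  by rewrite mulr_ge0_le0 // orient_swap -(orient_rot (q k)) oppr_le0 ltW.
- apply: mulr_le0; [exact: ltW|rewrite ev orient_aba mulr0 addr0].
  have p1 : w i * D j m i <= 0 by rewrite mulr_ge0_le0 // (orient_rot (q i)) ltW.
  have p2 : w k * D j m k <= 0 by rewrite mulr_ge0_le0 // -(orient_rot (q j)) ltW.
  by lra.
Qed.

(** Before the flip [x] lies in a triangle [ijz] with [z] equal to [m] or [k], hence in the common
    face of that triangle and [u]. It remains to remove [j] from the support. *)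
Lemma flip_meet t i j k m u x : triangulation q t ->
  [set i; j; k] \in t -> [set i; j; m] \in t -> 0 < D i j k -> D i j m < 0 ->
  u \in t -> u != [set i; j; k] -> u != [set i; j; m] ->
  simplex q u x -> simplex q [set m; k; i] x -> simplex q (u :&: [set m; k; i]) x.
Proof.
move=> tt kt mt hk hm ut uk um xu xi; have [t3 _ tI] := tt.
have [hi hj] := opposite_sides hq hm hk.
have [ij ik jk] := orient_neq (lt0r_neq0 hk).
have [mk mi ki] := orient_neq (lt0r_neq0 hi).
have [_ mj kj] := orient_neq (ltr0_neq0 hj).
have hx : 0 <= orient (q m) (q k) x.
  have [+ _ _] := (simplex3P hq x mk mi ki).1 xi.
  by rewrite pmulr_rge0.
(* A triangle on the edge [ij] lies on one of its sides, where [ijk] or [ijm] is the only one. *)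
have uij : (i \notin u) || (j \notin u).
  rewrite -negb_and; apply/negP => /andP[iu ju].
  have [p [uE ip jp]] := cards3_sub (t3 _ ut) iu ju ij.
  have [hp|hp] := ltP 0 (D i j p).
    have pt : [set i; j; p] \in t by rewrite -uE.
    by move: uk; rewrite uE (adjacent_uniq tt pt kt hp hk) eqxx.
  have pt : [set j; i; p] \in t by rewrite set3C -uE.
  have mt' : [set j; i; m] \in t by rewrite set3C.
  have hp' : 0 < D j i p by rewrite orientC oppr_gt0 lt_neqAle orient_neq0.
  have hm' : 0 < D j i m by rewrite orientC oppr_gt0.
  by move: um; rewrite uE (adjacent_uniq tt pt mt' hp' hm') eqxx.
have key z : z \in [set m; k] -> [set i; j; z] \in t -> simplex q [set i; j; z] x ->
    simplex q (u :&: [set m; k; i]) x.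
  move=> zmk zt xz; have : simplex q (u :&: [set i; j; z]) x by rewrite -tI.
  have mkz : D m k z = 0.
    by move: zmk; rewrite !inE => /orP[]/eqP->; rewrite ?orient_aba ?orient_abb.
  move=> /simplexP[w xw]; apply/simplexP; exists w; have [w0 wA w1 xE] := xw; split=> //.
  (* If [u] omits [i], a positive weight at [j] would put [x] strictly beyond [mk], against [hx];
     otherwise [u] omits [j]. *)
  have wj : w j = 0.
    have [iu|iu] := boolP (i \in u); last first.
      have := hx; rewrite (weights_affine xw (affine_orient _ _)) => hx'.
      apply/eqP; rewrite eq_le w0 andbT leNgt; apply/negP => wj.
      move: hx'; rewrite leNgt => /negP; apply.
      have [ju|ju] := boolP (j \in u); last first.
        by move: wj; rewrite wA ?ltxx // inE (negPf ju).
      rewrite (bigD1 j) /=; last by rewrite !inE ju eqxx orbT.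
      rewrite big1 ?addr0 ?pmulr_rlt0 // => a /andP[].
      rewrite !inE => /andP[au /orP[/orP[]|] /eqP ae]; rewrite ae ?eqxx //.
      - by move: au; rewrite ae (negPf iu).
      - by rewrite mkz mulr0.
    by apply: wA; move: uij; rewrite iu inE /= => /negPf ->.
  move=> a; have [->//|aj] := eqVneq a j.
  rewrite inE negb_and => /orP[au|]; first by apply: wA; rewrite inE (negPf au).
  move=> amki; apply: wA; rewrite inE negb_and; apply/orP; right.
  move: amki zmk; rewrite !inE !negb_or => /andP[/andP[am ak] ai] zmk; rewrite ai aj /=.
  by case/orP: zmk => /eqP ->.
have [h|h] : simplex q [set j; i; m] x \/ simplex q [set j; i; k] x.
  by apply: flip_cover xi => //; rewrite orientC ?oppr_gt0 ?oppr_lt0.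
- by apply: (key m); rewrite ?inE ?eqxx // set3C.
- by apply: (key k); rewrite ?inE ?eqxx ?orbT // set3C.
Qed.

Lemma flip_triangulation t i j k m : triangulation q t ->
  [set i; j; k] \in t -> [set i; j; m] \in t -> 0 < D i j k -> D i j m < 0 ->
  triangulation q (flip t i j k m).
Proof.
move=> tt kt mt hk hm; have [t3 tU tI] := tt.
have [hi hj] := opposite_sides hq hm hk.
have [ij ik jk] := orient_neq (lt0r_neq0 hk).
have [mk mi ki] := orient_neq (lt0r_neq0 hi).
have [_ mj kj] := orient_neq (ltr0_neq0 hj).
(* Exchanging [i] with [j] and [k] with [m] preserves the hypotheses, so [flip_meet] also serves the
   second new triangle. *)
have mj_new u x : u \in t -> u != [set i; j; k] -> u != [set i; j; m] ->
  simplex q u x -> simplex q [set m; k; j] x -> simplex q (u :&: [set m; k; j]) x.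
  move=> ut uk um; rewrite [ [set m; k; j] ]set3C.
  by apply: (@flip_meet t j i m k); rewrite // 1?[ [set j; i; _] ]set3C //
    orientC ?oppr_gt0 ?oppr_lt0.
have mkiE x : simplex q [set m; k; i] x -> simplex q [set m; k; j] x ->
    simplex q ([set m; k; i] :&: [set m; k; j]) x.
  move=> xi xj.
  have [hxi _ _] := (simplex3P hq x mk mi ki).1 xi.
  have [hxj _ _] := (simplex3P hq x mk mj kj).1 xj.
  rewrite pmulr_rge0 // in hxi; rewrite nmulr_rge0 // in hxj.
  have /eqP hx0 : orient (q m) (q k) x == 0 by rewrite eq_le hxj.
  have [w xw] := (simplexP _ _ _).1 xi.
  apply/simplexP; exists w; have [w0 wA w1 xE] := xw; split=> // a.
  have := weights_affine xw (affine_orient (q m) (q k)).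
  rewrite hx0 sum_set3 // orient_aba orient_abb !mulr0 !add0r.
  move/esym/eqP; rewrite mulf_eq0 (negPf (lt0r_neq0 hi)) orbF => /eqP wi.
  rewrite inE negb_and => /orP[/wA //|]; rewrite !inE !negb_or => /andP[/andP[am ak] aj].
  have [->//|ai] := eqVneq a i.
  by apply: wA; rewrite !inE !negb_or am ak.
have memP u : u \in flip t i j k m ->
    [\/ u = [set m; k; i], u = [set m; k; j] |
        [/\ u \in t, u != [set i; j; k] & u != [set i; j; m]] ].
  rewrite !inE => /orP[/eqP->|/orP[/eqP->|/and3P[um uk ut]]].
  - by constructor 1.
  - by constructor 2.
  - by constructor 3.
have mi_old u x : u \in t -> u != [set i; j; k] -> u != [set i; j; m] ->
  simplex q u x -> simplex q [set m; k; i] x -> simplex q (u :&: [set m; k; i]) x.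
  by move=> ut uk um; apply: (@flip_meet t i j k m).
have meet_sub s s' y : simplex q (s :&: s') y -> simplex q s y /\ simplex q s' y.
  by move=> sy; split; apply: simplexS sy; rewrite ?subsetIl ?subsetIr.
split.
- by move=> u /memP[->|->|[/t3]//]; rewrite cards3.
- apply/seteqP; split=> x /=.
    by move=> [s _ /= xs]; rewrite polygonE; apply: simplexS xs; rewrite finset.subsetT.
  rewrite -tU => -[u /= ut xu].
  have ini : simplex q [set m; k; i] x -> (\bigcup_(s in [set` flip t i j k m]) simplex q s)%classic x.
    by exists [set m; k; i]; rewrite //= !inE eqxx.
  have inj : simplex q [set m; k; j] x -> (\bigcup_(s in [set` flip t i j k m]) simplex q s)%classic x.
    by exists [set m; k; j]; rewrite //= !inE eqxx orbT.
  have [uk|uk] := eqVneq u [set i; j; k].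
    by rewrite uk in xu; case: (flip_cover hk hm xu) => [/ini|/inj].
  have [um|um] := eqVneq u [set i; j; m].
    have : simplex q [set k; m; j] x \/ simplex q [set k; m; i] x.
      apply: (@flip_cover j i m k); rewrite ?[ [set j; i; _] ]set3C -?um //.
        by rewrite orientC oppr_gt0.
      by rewrite orientC oppr_lt0.
    by rewrite ![ [set k; m; _] ]set3C => -[/inj|/ini].
  by exists u; rewrite //= !inE ut uk um !orbT.
- move=> s s' /memP hs /memP hs'; apply/seteqP; split=> x /=; last exact: meet_sub.
  case: hs => [->|->|[st sk sm]]; case: hs' => [->|->|[st' sk' sm']] [xs xs'];
    rewrite ?finset.setIid //.
  + exact: mkiE.
  + by rewrite finset.setIC; apply: mi_old.
  + by rewrite finset.setIC; apply: mkiE.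
  + by rewrite finset.setIC; apply: mj_new.
  + exact: mi_old.
  + exact: mj_new.
  + by rewrite -tI.
Qed.

End Flip.

(** * Areas and the pairing of GKZ vectors with heights *)

Lemma det_mx2 (R : comNzRingType) (M : 'M[R]_2) :
  \det M = M 0 0 * M 1 1 - M 0 1 * M 1 0.
Proof.
rewrite (expand_det_row _ 0) !big_ord_recl big_ord0 addr0 /cofactor !det_mx11 !mxE /=.
have -> : lift 0 0 = 1 :> 'I_2 by apply: val_inj.
have -> : lift 1 0 = 0 :> 'I_2 by apply: val_inj.
by rewrite expr0 expr1; ring.
Qed.

Lemma triangle_areaE (R : realType) (a b c : 'rV[R]_2) :
  triangle_area a b c = `|orient a b c| / 2.
Proof.
rewrite /triangle_area det_mx2.
have e0 (u v : 'rV[R]_2) k : (col_mx u v : 'M[R]_2) 0 k = u 0 k.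
  by rewrite -(col_mxEu u v); congr fun_of_matrix; apply: val_inj.
have e1 (u v : 'rV[R]_2) k : (col_mx u v : 'M[R]_2) 1 k = v 0 k.
  by rewrite -(col_mxEd u v); congr fun_of_matrix; apply: val_inj.
by rewrite !e0 !e1 !mxE.
Qed.

Section Gkz.
Variables (R : realType) (N : nat) (q : 'I_N -> 'rV[R]_2).
Hypothesis hq : convex_gon q.
Implicit Types (A B s u : {set 'I_N}) (i j k m a b c d p : 'I_N) (x : 'rV[R]_2).
Implicit Types (t : {set {set 'I_N}}) (h : 'I_N -> R).
Local Notation D i j k := (orient (q i) (q j) (q k)).

(** For a triangle this is three times the integral of the affine interpolation of [h]. *)
Definition pairing_at s h := vol q s * \sum_(i in s) h i.

Definition pairing t h := \sum_(s in t) pairing_at s h.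

Lemma gkz_pairing t (c : 'cV[R]_N) :
  (gkz_vector q t *m c) 0 0 = pairing t (fun i => c i 0).
Proof.
rewrite mxE /pairing.
under eq_bigr => i _.
  rewrite /gkz_vector summxE (bigD1 i) //= [X in _ + X]big1 => [|j ji].
    rewrite addr0 summxE.
    under eq_bigr do rewrite !mxE !eqxx mulr1.
    over.
  by rewrite summxE big1 // => s _; rewrite !mxE eq_sym (negPf ji) andbF mulr0.
under eq_bigr do rewrite mulr_suml.
rewrite (exchange_big_dep (mem t)) /= => [|i s _ /andP[] //].
apply: eq_bigr => s st; rewrite /pairing_at mulr_sumr.
by apply: eq_bigl => i; rewrite st.
Qed.

Lemma vol3 i j k : i != j -> i != k -> j != k ->
  vol q [set i; j; k] = `|D i j k| / 2.
Proof.
move=> ij ik jk; rewrite /vol.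
have : size (enum [set i; j; k]) = 3%N by rewrite -cardE cards3.
have : uniq (enum [set i; j; k]) by rewrite enum_uniq.
have : forall z, z \in enum [set i; j; k] = (z \in [set i; j; k]) by move=> z; rewrite mem_enum.
case: (enum _) => [//|a [//|b [//|c [|//]]]] mem /= /andP[/norP[ab]].
rewrite !inE => ac /andP[bc _] _.
have := mem a; have := mem b; have := mem c; rewrite !inE !eqxx ?orbT /=.
rewrite triangle_areaE.
move=> /esym/orP[/orP[]|] /eqP ce /esym/orP[/orP[]|] /eqP be /esym/orP[/orP[]|] /eqP ae.
all: move: ab ac bc; rewrite ae be ce ?eqxx // => _ _ _; congr (_ / 2).
- by rewrite orientC normrN orient_rot.
- by rewrite orient_rot.
- by rewrite -orient_rot.
- by rewrite orient_swap normrN.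
- by rewrite orientC normrN.
Qed.

Lemma pairing_at3 h i j k : i != j -> i != k -> j != k ->
  pairing_at [set i; j; k] h = `|D i j k| / 2 * (h i + h j + h k).
Proof. by move=> ij ik jk; rewrite /pairing_at vol3 // sum_set3. Qed.

(** Only four triangles are involved, and [affine_dep] combines their contributions. With [l] the
    plane over the triangle [ijk], the flip increases the pairing exactly when the lifted [m] is
    above that plane. *)
Lemma pairing_flip t i j k m h (l : 'rV[R]_2 -> R) : triangulation q t ->
  [set i; j; k] \in t -> [set i; j; m] \in t -> 0 < D i j k -> D i j m < 0 ->
  affine_fun l -> l (q i) = h i -> l (q j) = h j -> l (q k) = h k ->
  pairing (flip t i j k m) h - pairing t h = D i j k / 2 * (h m - l (q m)).
Proof.
move=> tt kt mt hk hm hl li lj lk.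
have [hi hj] := opposite_sides hq hm hk.
have [ij ik jk] := orient_neq (lt0r_neq0 hk).
have [mk mi ki] := orient_neq (lt0r_neq0 hi).
have [_ mj kj] := orient_neq (ltr0_neq0 hj).
(* The segments [ij] and [mk] cross, so [mk] is not an edge of [t] and neither new triangle is
   already counted. *)
have mk_t s : m \in s -> k \in s -> s \notin t.
  move=> ms ks; apply/negP => st; have mk_u := uncrossed_edge hq tt st ms ks mk.
  have := mk_u [set i; j; k] i j kt; rewrite !inE !eqxx orbT /= => /(_ isT isT hi).
  by rewrite leNgt hj.
have mki_t : [set m; k; i] \notin t by rewrite mk_t ?inE ?eqxx ?orbT.
have mkj_t : [set m; k; j] \notin t by rewrite mk_t ?inE ?eqxx ?orbT.
have mkij : [set m; k; i] != [set m; k; j].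
  apply: contraNneq ij => /setP/(_ i); rewrite !inE eqxx orbT.
  by rewrite ![i == _]eq_sym (negPf mi) (negPf ki) /= eq_sym.
have kmE : [set i; j; m] != [set i; j; k].
  apply: contraNneq mk => /setP/(_ m); rewrite !inE eqxx orbT.
  by rewrite (negPf mi) (negPf mj) /=.
rewrite /pairing /flip big_setU1 /=; last first.
  by rewrite !inE (negPf mkij) (negPf mki_t) !andbF.
rewrite big_setU1 /=; last by rewrite !inE (negPf mkj_t) !andbF.
rewrite [X in _ - X](big_setD1 [set i; j; k]) //=.
rewrite [X in _ - (_ + X)](big_setD1 [set i; j; m]) /=; last by rewrite !inE kmE.
set rest := \sum_(s in _) _.
have im : i != m by rewrite eq_sym.
have jm : j != m by rewrite eq_sym.
rewrite !pairing_at3 // (gtr0_norm hi) (ltr0_norm hj) (gtr0_norm hk) (ltr0_norm hm).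
have e := affine_dep (q i) (q j) (q k) (q m) hl.
rewrite li lj lk in e.
have -> : D i j k / 2 * (h m - l (q m)) = (D i j k * h m - D i j k * l (q m)) / 2 by ring.
by rewrite e /orient; field.
Qed.

End Gkz.

(** * From local to global concavity *)

Section Concavity.
Variables (R : realType) (N : nat) (q : 'I_N -> 'rV[R]_2).
Hypothesis hq : convex_gon q.
Implicit Types (A B s u : {set 'I_N}) (i j k m a b c d p z : 'I_N) (x : 'rV[R]_2).
Implicit Types (t : {set {set 'I_N}}) (h : 'I_N -> R) (l : 'rV[R]_2 -> R).
Local Notation D i j k := (orient (q i) (q j) (q k)).

Lemma ccw4' a b c d : D b c d != 0 -> D a c d != 0 -> D a b d != 0 -> D a b c != 0 ->
  ccw q b c d (+) ccw q a c d (+) ccw q a b d (+) ccw q a b c = false.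
Proof.
move=> /orient_neq[bc bd cd] /orient_neq[ac ad _] /orient_neq[ab _ _] _.
exact: ccw4.
Qed.

(** Were [z] not on the side of [m], the parity relation would make all four terms of the identity
    [e] negative. This gives the descent in [locally_concave_beyond]. *)
Lemma beyond_edge i j m z : 0 < D j i m -> D i m z < 0 \/ D m j z < 0 -> 0 < D j i z.
Proof.
move=> hm hz; rewrite ltNge; apply/negP => h.
have [ji jm im] := orient_neq (lt0r_neq0 hm).
have zj : j != z.
  apply/eqP => e; move: hz; rewrite -e orient_abb ltxx (orient_rot (q j)).
  by rewrite ltNge (ltW hm) => -[].
have zi : i != z.
  apply/eqP => e; move: hz; rewrite -e orient_aba ltxx (orient_rot (q i)).
  by rewrite (orient_rot (q j)) ltNge (ltW hm) => -[].
have zm : m != z.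
  by apply/eqP => e; move: hz; rewrite -e orient_abb orient_aba ltxx => -[].
have n0 := orient_neq0 hq ji zj zi; have n1 := orient_neq0 hq jm zj zm.
have n2 := orient_neq0 hq im zi zm.
have {}h : D j i z < 0 by rewrite lt_neqAle n0.
have e : D i m z - D j m z + D j i z - D j i m = 0 by rewrite /orient; ring.
have o : D j m z = - D m j z by rewrite orientC.
have := ccw4' n2 n1 n0 (lt0r_neq0 hm).
rewrite /ccw hm; have -> : 0 < D j i z = false by rewrite ltNge (ltW h).
by case: hz => hz; case: (ltP 0 (D i m z)) => //; case: (ltP 0 (D j m z)) => // *; lra.
Qed.

Definition locally_concave t h := forall i j k m l,
  [set i; j; k] \in t -> [set i; j; m] \in t -> 0 < D i j k -> D i j m < 0 ->
  affine_fun l -> l (q i) = h i -> l (q j) = h j -> l (q k) = h k -> h m <= l (q m).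

Lemma maximizer_locally_concave t h : triangulation q t ->
  (forall t', triangulation q t' -> pairing q t' h <= pairing q t h) ->
  locally_concave t h.
Proof.
move=> tt tmax i j k m l kt mt hk hm hl li lj lk.
have := tmax _ (flip_triangulation hq tt kt mt hk hm).
rewrite -subr_le0 (pairing_flip hq tt kt mt hk hm hl li lj lk).
by rewrite pmulr_rle0 ?divr_gt0 // subr_le0.
Qed.

(** Induction on the number of vertices beyond [ij]. The plane [l'] over the neighbouring triangle
    is below [l] beyond [ij], and [p], unless it is the apex [m], lies beyond one of the other two
    edges of this neighbour, where there are fewer vertices. *)
Lemma locally_concave_beyond t h : triangulation q t -> locally_concave t h ->
  forall n i j k p l, (#|[set z | (D i j z < 0)%R]| < n)%N ->
  [set i; j; k] \in t -> 0 < D i j k -> affine_fun l ->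
  l (q i) = h i -> l (q j) = h j -> l (q k) = h k -> D i j p < 0 -> h p <= l (q p).
Proof.
move=> tt tc; elim=> // n IH i j k p l cardn kt hk hl li lj lk hp.
have [ij ik jk] := orient_neq (lt0r_neq0 hk).
have [||m mt hm] := @adjacent _ _ _ hq t j i p tt.
- by apply/uncrossedC/(uncrossed_edge hq tt kt); rewrite ?inE ?eqxx ?orbT.
- by rewrite orientC oppr_gt0.
have [ji jm im] := orient_neq (lt0r_neq0 hm).
have mt' : [set i; j; m] \in t by rewrite set3C.
have hm' : D i j m < 0 by rewrite orientC oppr_lt0.
have lm : h m <= l (q m) by apply: (tc i j k m).
have [l' hl' [l'i l'j l'm]] := affine_interp (h i) (h j) (h m) (ltr0_neq0 hm').
have [->//|pm] := eqVneq p m.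
have ll' : l' (q p) <= l (q p).
  have := affine_line (q m) (q p) (affine_add hl (affine_opp hl')).
  move=> /(_ (q i) (q j)); rewrite li lj l'i l'j !subrr => /(_ erefl erefl) e.
  rewrite -subr_ge0; rewrite -(nmulr_rle0 _ hm') e l'm.
  by rewrite nmulr_rle0 // subr_ge0.
apply: le_trans ll'.
have hp' : 0 < D j i p by rewrite orientC oppr_gt0.
have [_ jp ip] := orient_neq (lt0r_neq0 hp').
have mp : m != p by rewrite eq_sym.
(* Vertices beyond [im] or [mj] are beyond [ij], and [m] no longer counts, so the number drops. *)
have sub (P : pred 'I_N) : (forall z, P z -> D i m z < 0 \/ D m j z < 0) -> ~~ P m ->
    (#|[set z | P z]| < n)%N.
  move=> hP Pm; rewrite -ltnS; apply: leq_trans cardn; rewrite ltnS.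
  apply: proper_card; apply/properP; split.
    apply/fintype.subsetP => z; rewrite !inE => /hP /(beyond_edge hm).
    by rewrite orientC oppr_gt0.
  by exists m; rewrite !inE.
(* Parity makes [ccw q i m p] and [ccw q j m p] equal, so [p] is beyond [im] or beyond [mj]. *)
have := ccw4 hq ji jm jp im ip mp; rewrite [ccw q j i p]/ccw hp' [ccw q j i m]/ccw hm.
rewrite !addbT negbK => par.
have [him|him] := boolP (ccw q i m p); last first.
  apply: (IH i m j) => //; rewrite ?ccwN //.
  - by apply: sub => [z|]; [left|rewrite orient_abb ltxx].
  - by rewrite set3s.
  - by rewrite (orient_rot (q j)).
have {}him : D m j p < 0.
  by move: par; rewrite him /= /ccw orientC oppr_gt0; case: ltP.
apply: (IH m j i) => //.
- by apply: sub => [z|]; [right|rewrite orient_aba ltxx].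
- by rewrite set3s set3r.
- by rewrite -(orient_rot (q m)).
Qed.

(** By parity a further vertex cannot be on the inner side of all three edges, so
    [locally_concave_beyond] applies to one of them. *)
Lemma locally_concave_above t h i j k p l : triangulation q t -> locally_concave t h ->
  [set i; j; k] \in t -> D i j k != 0 -> affine_fun l ->
  l (q i) = h i -> l (q j) = h j -> l (q k) = h k -> h p <= l (q p).
Proof.
move=> tt tc + + hl; wlog hk : i j / 0 < D i j k => [H kt D0 li lj lk|].
  have [hk|hk] := ltP 0 (D i j k); first exact: (H i j).
  apply: (H j i) => //.
  - by rewrite orientC oppr_gt0 lt_neqAle D0.
  - by rewrite set3C.
  - by rewrite orientC oppr_eq0.
move=> kt _ li lj lk.
have [ij ik jk] := orient_neq (lt0r_neq0 hk).
have [->|pi] := eqVneq p i; first by rewrite li.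
have [->|pj] := eqVneq p j; first by rewrite lj.
have [->|pk] := eqVneq p k; first by rewrite lk.
rewrite eq_sym in pi; rewrite eq_sym in pj; rewrite eq_sym in pk.
have := ccw4 hq ij ik pi jk pj pk; rewrite [ccw q i j k]/ccw hk.
have [h1|h1] := boolP (ccw q i j p); last first.
  by move=> _; apply: (locally_concave_beyond tt tc (ltnSn _) kt hk) => //; apply: ccwN.
have [h2|h2] := boolP (ccw q j k p); last first.
  move=> _; apply: (locally_concave_beyond tt tc (ltnSn _) (i := j) (j := k) (k := i)) => //.
  - by rewrite -set3r.
  - by rewrite orient_rot.
  - exact: ccwN.
case h3: (ccw q i k p) => // _.
apply: (locally_concave_beyond tt tc (ltnSn _) (i := k) (j := i) (k := j)) => //.
- by rewrite set3r.
- by rewrite -orient_rot.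
- by rewrite orientC oppr_lt0.
Qed.

End Concavity.

(** * Integrals over one side of a line *)

Section Additivity.
Variables (R : realType) (N : nat) (q : 'I_N -> 'rV[R]_2).
Hypothesis hq : convex_gon q.
Implicit Types (A B s u : {set 'I_N}) (i j k m a b c d p z : 'I_N) (x : 'rV[R]_2).
Implicit Types (t : {set {set 'I_N}}) (h : 'I_N -> R) (g l : 'rV[R]_2 -> R).
Local Notation D i j k := (orient (q i) (q j) (q k)).

Definition in_side g s := [forall a in s, 0 <= g (q a)].

Lemma in_side3 g a b c :
  in_side g [set a; b; c] = [&& 0 <= g (q a), 0 <= g (q b) & 0 <= g (q c)].
Proof.
apply/forall_inP/and3P => [H|[ha hb hc] z].
  by split; apply: H; rewrite !inE eqxx ?orbT.
by rewrite !inE => /orP[/orP[]|] /eqP->.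
Qed.

(* The integral of l over a triangle is, up to a factor, the sum of
   edge_weight l over its positively oriented edges; the contributions of an
   interior edge from its two sides cancel. *)
Definition edge_weight l (a b : 'rV[R]_2) := orient 0 a b * (l 0 + l a + l b).

(** A directed edge with a triangle of the chosen side on its left; an edge interior to the side
    occurs in both directions. *)
Definition side_edge t g a b :=
  [exists c, [&& [set a; b; c] \in t, in_side g [set a; b; c] & 0 < D a b c]].

Lemma edge_weightC l a b : edge_weight l (q b) (q a) = - edge_weight l (q a) (q b).
Proof. by rewrite /edge_weight orient_swap; ring. Qed.

(** The triangle is the signed sum of the three triangles that its edges span with the origin. *)
Lemma edge_weight_cycle l i j k : affine_fun l ->
  edge_weight l (q i) (q j) + edge_weight l (q j) (q k) + edge_weight l (q k) (q i) =
  D i j k * (l (q i) + l (q j) + l (q k)).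
Proof.
by move=> [u [v [w lE]]]; rewrite /edge_weight !lE /orient !mxE; ring.
Qed.

(** The indicator picks the three edges of [s] in their positive direction; summing over all ordered
    pairs allows an exchange with the sum over triangles. *)
Lemma pairing_at_edges s l : #|s| = 3%N -> affine_fun l ->
  pairing_at q s (fun i => l (q i)) =
  2^-1 * \sum_a \sum_b edge_weight l (q a) (q b) *
    \sum_c ([&& a \in s, b \in s, c \in s & 0 < D a b c])%:R.
Proof.
move=> s3 hl.
have [i [j [k [-> hk]]]] : exists i j k, s = [set i; j; k] /\ 0 < D i j k.
  have [i [j [k [-> ij ik jk]]]] := cards3P s3.
  have [hk|hk] := ltP 0 (D i j k); first by exists i, j, k.
  exists j, i, k; rewrite set3C; split=> //.
  by rewrite orientC oppr_gt0 lt_neqAle orient_neq0.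
have [ij ik jk] := orient_neq (lt0r_neq0 hk).
rewrite pairing_at3 // (gtr0_norm hk) mulrAC -edge_weight_cycle // mulrC; congr (_ * _).
rewrite (sum_supp3 ij ik jk); last first.
  move=> a /negPf aS; apply: big1 => b _; rewrite big1 ?mulr0 // => c _.
  by rewrite aS.
have inner a : \sum_b edge_weight l (q a) (q b) *
    \sum_c ([&& a \in [set i; j; k], b \in [set i; j; k], c \in [set i; j; k] & 0 < D a b c])%:R
  = \sum_(b in [set i; j; k]) edge_weight l (q a) (q b) *
    \sum_(c in [set i; j; k]) ((a \in [set i; j; k]) && (0 < D a b c))%:R.
  rewrite [LHS](bigID (mem [set i; j; k])) /= [X in _ + X]big1 ?addr0 => [|b /negPf bS].
    apply: eq_bigr => b bS; congr (_ * _).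
    rewrite [LHS](bigID (mem [set i; j; k])) /= [X in _ + X]big1 ?addr0 => [|c /negPf cS].
      by apply: eq_bigr => c cS; rewrite bS cS.
    by rewrite cS !andbF.
  by rewrite big1 ?mulr0 // => c _; rewrite bS andbF.
rewrite !inner !sum_set3 // !inE !eqxx !orbT /=.
have hk1 : 0 < D j k i by rewrite orient_rot.
have hk2 : 0 < D k i j by rewrite -orient_rot.
have n1 : 0 < D j i k = false by rewrite orientC oppr_gt0 ltNge (ltW hk).
have n2 : 0 < D k j i = false by rewrite orientC oppr_gt0 ltNge (ltW hk1).
have n3 : 0 < D i k j = false by rewrite orientC oppr_gt0 ltNge (ltW hk2).
rewrite !(orient_aac, orient_aba, orient_abb) ltxx hk hk1 hk2 n1 n2 n3 /=.
by ring.
Qed.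

Lemma side_edgeE t g a b : triangulation q t ->
  \sum_c \sum_(s in t | in_side g s)
    ([&& a \in s, b \in s, c \in s & 0 < D a b c])%:R = (side_edge t g a b)%:R :> R.
Proof.
move=> tt; have [t3 _ _] := tt.
have inner c : \sum_(s in t | in_side g s)
    ([&& a \in s, b \in s, c \in s & 0 < D a b c])%:R =
    [&& [set a; b; c] \in t, in_side g [set a; b; c] & 0 < D a b c]%:R :> R.
  have [hc|hc] := ltP 0 (D a b c); last first.
    by rewrite big1 ?andbF // => s _; rewrite !andbF.
  have [ab ac bc] := orient_neq (lt0r_neq0 hc).
  have sE s : s \in t -> a \in s -> b \in s -> c \in s -> s = [set a; b; c].
    move=> st as_ bs cs; apply/esym/eqP; rewrite eqEcard t3 // cards3 // andbT.
    by apply/fintype.subsetP => z; rewrite !inE => /orP[/orP[]|] /eqP->.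
  have [/andP[abct abcg]|nabc] := boolP (([set a; b; c] \in t) && in_side g [set a; b; c]).
    rewrite (bigD1 [set a; b; c]) /=; last by rewrite abct.
    rewrite !inE !eqxx !orbT abct abcg /= big1 ?addr0 // => s /andP[/andP[st _] sn].
    by case: and3P => // -[as_ bs /andP[cs _]]; rewrite (sE s) ?eqxx in sn.
  rewrite big1 => [|s /andP[st sg]].
    by move: nabc; rewrite negb_and => /orP[] /negPf -> //=; rewrite andbF.
  case: and3P => // -[as_ bs /andP[cs _]].
  by move: nabc; rewrite -(sE s) // st sg.
under eq_bigr do rewrite inner.
have [/existsP[c hc]|nc] := boolP (side_edge t g a b).
  rewrite (bigD1 c) //= hc big1 ?addr0 // => c' cc'.
  case: and3P => // -[ct' _ hc']; move: hc => /and3P[ct _ hc].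
  by move: cc'; rewrite (adjacent_uniq tt ct ct' hc hc') eqxx.
rewrite big1 // => c _; move: nc; rewrite /side_edge negb_exists => /forallP/(_ c) /negPf.
by move=> ->.
Qed.

Definition side_pairing t g h := \sum_(s in t | in_side g s) pairing_at q s h.

(** Averaging with the reversed edges, by the antisymmetry of [edge_weight], leaves only the
    boundary edges of the side. One factor one half comes from the area, the other from the
    average. *)
Lemma side_pairing_edges t g l : triangulation q t -> affine_fun l ->
  side_pairing t g (fun i => l (q i)) =
  4^-1 * \sum_a \sum_b edge_weight l (q a) (q b) *
     ((side_edge t g a b)%:R - (side_edge t g b a)%:R).
Proof.
move=> tt hl; have [t3 _ _] := tt.
transitivity (2^-1 * \sum_a \sum_b edge_weight l (q a) (q b) * (side_edge t g a b)%:R).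
  rewrite /side_pairing.
  under eq_bigr => s /andP[st _] do rewrite (pairing_at_edges (t3 s st) hl).
  rewrite -mulr_sumr exchange_big /=; congr (_ * _); apply: eq_bigr => a _.
  rewrite exchange_big /=; apply: eq_bigr => b _.
  by rewrite -mulr_sumr exchange_big /= side_edgeE.
have -> : 4^-1 = 2^-1 * 2^-1 :> R by field.
rewrite -mulrA; congr (_ * _).
under [X in 2^-1 * X]eq_bigr do under eq_bigr do rewrite mulrBr.
under [X in 2^-1 * X]eq_bigr do rewrite sumrB.
rewrite sumrB [X in _ - X]exchange_big /=.
under [X in _ - X]eq_bigr do under eq_bigr do rewrite edge_weightC mulNr.
under [X in _ - X]eq_bigr do rewrite sumrN.
rewrite sumrN opprK -mulr2n -[X in _ * X]mulr_natl mulrA mulVf ?mul1r //.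
by rewrite pnatr_eq0.
Qed.

(** A boundary edge [ab] has no vertex with [g >= 0] strictly on its right ([H]). This does not
    depend on the triangulation and yields the same edge in [t']. *)
Lemma side_boundary t t' g a b : triangulation q t -> triangulation q t' ->
  affine_fun g -> one_sided q t g -> one_sided q t' g ->
  side_edge t g a b -> ~~ side_edge t g b a ->
  side_edge t' g a b && ~~ side_edge t' g b a.
Proof.
move=> tt tt' hg gt gt' /existsP[c /and3P[ct]]; rewrite in_side3 => /and3P[ga gb gc] hc hba.
have [ab ac bc] := orient_neq (lt0r_neq0 hc).
(* A triangle on [ab] that reaches the negative side forces [g] to vanish along [ab]. *)
have zero t0 m : one_sided q t0 g -> [set a; b; m] \in t0 -> g (q m) < 0 ->
    g (q a) = 0 /\ g (q b) = 0.
  move=> h0 mt gm; split; apply/eqP; rewrite eq_le ?ga ?gb andbT leNgt; apply/negP => g0.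
    have := h0 _ a m mt; rewrite !inE !eqxx !orbT => /(_ isT isT g0).
    by rewrite leNgt gm.
  have := h0 _ b m mt; rewrite !inE !eqxx !orbT => /(_ isT isT g0).
  by rewrite leNgt gm.
have H p : 0 <= g (q p) -> 0 <= D a b p.
  move=> gp; rewrite leNgt; apply/negP => hp.
  have [||m mt hm] := @adjacent _ _ _ hq t b a p tt.
  - by apply/uncrossedC/(uncrossed_edge hq tt ct); rewrite ?inE ?eqxx ?orbT.
  - by rewrite orientC oppr_gt0.
  move: hba => /negP; apply; apply/existsP; exists m; rewrite mt hm andbT in_side3 ga gb /=.
  rewrite leNgt; apply/negP => gm; rewrite set3C in mt.
  have [za zb] := zero _ _ gt mt gm.
  have := affine_line (q m) (q p) hg za zb; have hm' : D a b m < 0.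
    by rewrite orientC oppr_lt0.
  move=> e; have : D a b m * g (q p) <= 0 by rewrite nmulr_rle0.
  by rewrite e leNgt nmulr_rgt0 // gm.
apply/andP; split; last first.
  apply/negP => /existsP[m /and3P[_]]; rewrite in_side3 => /and3P[_ _ gm].
  by rewrite orientC oppr_gt0 ltNge H.
(* If an edge crossed [ab], its end on the right would have [g < 0] and the other end [g <= 0],
   while [g >= 0] at the crossing point. *)
have un : uncrossed q t' a b.
  move=> u c1 c2 ut c1u c2u h1; rewrite leNgt; apply/negP => h2.
  have [x [y [z [w [[x0 y0 z0 w0] xy zw e]]]]] := crossing hq h2 h1.
  have g2 : g (q c2) < 0 by rewrite ltNge; apply: contraL h2 => /H; rewrite leNgt.
  have g1 : g (q c1) <= 0.
    by rewrite leNgt; apply/negP => g1; have := gt' u c1 c2 ut c1u c2u g1; rewrite leNgt g2.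
  have geq : x * g (q a) + y * g (q b) = z * g (q c2) + w * g (q c1).
    by rewrite -!affine_comb2 // e.
  have n1 : 0 <= x * g (q a) by rewrite mulr_ge0 // ltW.
  have n2 : 0 <= y * g (q b) by rewrite mulr_ge0 // ltW.
  have n3 : z * g (q c2) < 0 by rewrite pmulr_rlt0.
  have n4 : w * g (q c1) <= 0 by rewrite pmulr_rle0.
  by lra.
have [m mt hm] := adjacent hq tt' un hc.
apply/existsP; exists m; rewrite mt hm andbT in_side3 ga gb /=.
rewrite leNgt; apply/negP => gm; have [za zb] := zero _ _ gt' mt gm.
have e := affine_line (q m) (q c) hg za zb.
have : 0 <= D a b m * g (q c) by rewrite mulr_ge0 // ltW.
by rewrite e leNgt pmulr_rlt0 // gm.
Qed.

(** After [side_pairing_edges] only boundary edges count, and [side_boundary], used both ways, shows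
    that they are shared. *)
Lemma side_pairing_const t t' g l : triangulation q t -> triangulation q t' ->
  affine_fun g -> one_sided q t g -> one_sided q t' g -> affine_fun l ->
  side_pairing t g (fun i => l (q i)) = side_pairing t' g (fun i => l (q i)).
Proof.
move=> tt tt' hg gt gt' hl; rewrite !side_pairing_edges //; congr (_ * _).
apply: eq_bigr => a _; apply: eq_bigr => b _; congr (_ * _).
have K1 := side_boundary tt tt' hg gt gt'.
have K2 := side_boundary tt' tt hg gt' gt.
have := K1 a b; have := K1 b a; have := K2 a b; have := K2 b a.
case: (side_edge t g a b); case: (side_edge t g b a);
case: (side_edge t' g a b); case: (side_edge t' g b a) => //=;
rewrite ?subrr //.
all: by move=> h1 h2 h3 h4; do [move: (h1 isT isT) | move: (h2 isT isT)
  | move: (h3 isT isT) | move: (h4 isT isT)].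
Qed.

End Additivity.

(** * Faces, affine hulls and dimension *)

Section Faces.
Variables (R : realType) (m : nat).
Implicit Types (P F V : set 'rV[R]_m) (x y z : 'rV[R]_m) (c e : 'cV[R]_m).

Definition eval c x : R := (x *m c) 0 0.

Lemma evalB c x y : eval c (x - y) = eval c x - eval c y.
Proof. by rewrite /eval mulmxBl !mxE. Qed.

Lemma evalD c x y : eval c (x + y) = eval c x + eval c y.
Proof. by rewrite /eval mulmxDl !mxE. Qed.

Lemma evalZ c r x : eval c (r *: x) = r * eval c x.
Proof. by rewrite /eval -scalemxAl !mxE. Qed.

Lemma eval_sum c (k : nat) (p : 'I_k -> 'rV[R]_m) (r : 'I_k -> R) :
  eval c (\sum_i r i *: p i) = \sum_i r i * eval c (p i).
Proof. by rewrite /eval mulmx_suml summxE; apply: eq_bigr => i _; rewrite -scalemxAl mxE. Qed.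

Lemma sub_convex_hull V x : V x -> convex_hull V x.
Proof.
move=> Vx; exists 1%N, (fun=> x), (fun=> 1).
by rewrite !big_ord_recl !big_ord0 !addr0 scale1r.
Qed.

Lemma sub_affine_hull V x : V x -> affine_hull V x.
Proof.
move=> Vx; exists 1%N, (fun=> x), (fun=> 1).
by rewrite !big_ord_recl !big_ord0 !addr0 scale1r.
Qed.

Lemma affine_hullS F P x : (F `<=` P)%classic -> affine_hull F x -> affine_hull P x.
Proof. by move=> FP [k [p [r [pF r1 ->]]]]; exists k, p, r; split=> // i; apply: FP. Qed.

Lemma eval_affine_hull c b F x : (forall y, F y -> eval c y = b) ->
  affine_hull F x -> eval c x = b.
Proof.
move=> hF [k [p [r [pF r1 ->]]]]; rewrite eval_sum.
by under eq_bigr do rewrite hF //; rewrite -mulr_suml r1 mul1r.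
Qed.

(** Complementary slackness: the generators with nonzero coefficient must themselves attain [b]. *)
Lemma eval_convex_face c e b b' V x : (forall y, V y -> eval c y <= b) ->
  (forall y, V y -> eval c y = b -> eval e y = b') ->
  convex_hull V x -> eval c x = b -> eval e x = b'.
Proof.
move=> cb ceq [k [p [r [pV r0 r1 ->]]]]; rewrite !eval_sum => cx.
have z i : r i * (b - eval c (p i)) = 0.
  have /psumr_eq0P h : \sum_i r i * (b - eval c (p i)) = 0.
    under eq_bigr do rewrite mulrBr.
    by rewrite sumrB cx -mulr_suml r1 mul1r subrr.
  by apply: h => // j _; rewrite mulr_ge0 // subr_ge0 cb.
rewrite -[RHS]mul1r -r1 mulr_suml; apply: eq_bigr => i _.
have /eqP := z i; rewrite mulf_eq0 => /orP[/eqP->|]; first by rewrite !mul0r.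
by rewrite subr_eq0 => /eqP /esym h; rewrite ceq.
Qed.

Lemma convex_face_vertex c b V x : (forall y, V y -> eval c y <= b) ->
  convex_hull V x -> eval c x = b -> exists2 v, V v & eval c v = b.
Proof.
move=> cb Vx cx; apply: contrapT => hn.
(* If no generator attained [b], [eval_convex_face] would apply vacuously to [c] itself with the
   absurd value [b + 1]. *)
have zero y : V y -> eval c y = b -> eval c y = b + 1.
  by move=> Vy cy; case: hn; exists y.
have := eval_convex_face cb zero Vx cx; rewrite cx => /eqP.
by rewrite -subr_eq0 opprD addNKr oppr_eq0 oner_eq0.
Qed.

Lemma has_dim_nonempty F d : has_dim F d -> exists x, F x.
Proof.
move=> [x [B [_ hF]]]; have : affine_hull F x.
  by rewrite hF; exists 0 => //; rewrite mul0mx addr0.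
move=> [[|k] [p [r [pF r1 _]]]]; last by exists (p ord0).
by move: r1; rewrite big_ord0 => /esym/eqP; rewrite oner_eq0.
Qed.

Lemma affine_param_sub F P x y d d' (B : 'M[R]_(d, m)) (B' : 'M[R]_(d', m)) :
  affine_hull F = [set x + u *m B | u in [set: 'rV[R]_d]]%classic ->
  affine_hull P = [set y + u *m B' | u in [set: 'rV[R]_d']]%classic ->
  (F `<=` P)%classic -> (B <= B')%MS.
Proof.
move=> hF hP FP.
have inP u : exists u', x + u *m B = y + u' *m B'.
  have : affine_hull P (x + u *m B).
    by apply: affine_hullS FP _; rewrite hF; exists u.
  by rewrite hP => -[u' _ <-]; exists u'.
apply/row_subP => i; have [u0] := inP 0; have [u1] := inP (delta_mx 0 i).
rewrite mul0mx addr0 -rowE => h1 h0.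
have -> : row i B = (u1 - u0) *m B'.
  by rewrite mulmxBl -[LHS](addKr x) h1 [in - x]h0 opprD addrACA addNr add0r addrC.
exact: submxMl.
Qed.

Lemma affine_param_diff P y d (B : 'M[R]_(d, m)) x x' :
  affine_hull P = [set y + u *m B | u in [set: 'rV[R]_d]]%classic ->
  P x -> P x' -> (x - x' <= B)%MS.
Proof.
move=> hP /sub_affine_hull + /sub_affine_hull; rewrite hP => -[u _ <-] [u' _ <-].
by rewrite opprD addrACA subrr add0r -mulmxBl submxMl.
Qed.

(* On a facet F the functional c is constant, and so is e: both vanish on the
   directions of F, which have codimension one among those of P. *)
Lemma facet_functional P F d c e b b' : has_dim P d.+1 -> has_dim F d ->
  (F `<=` P)%classic ->
  (forall x, F x -> eval c x = b) -> (forall x, F x -> eval e x = b') ->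
  (exists x y, [/\ P x, P y & eval c x != eval c y]) ->
  exists r, forall x y, P x -> P y -> eval e x - eval e y = r * (eval c x - eval c y).
Proof.
move=> [y0 [BP [fP hP]]] [x0 [BF [fF hF]]] FP cF eF [x1 [x2 [Px1 Px2 c12]]].
have vanish (a : 'cV[R]_m) (v : R) : (forall x, F x -> eval a x = v) -> forall u, eval a (u *m BF) = 0.
  move=> aF u; have H w : eval a (x0 + w *m BF) = v.
    by apply: eval_affine_hull aF _; rewrite hF; exists w.
  by rewrite -[_ *m _](addKr x0) evalD -scaleN1r evalZ H -(H 0) mul0mx addr0 mulN1r addNr.
pose z := x1 - x2.
have cz : eval c z != 0 by rewrite evalB subr_eq0.
have zBF : ~~ (z <= BF)%MS.
  by apply: contra cz => /submxP[u ->]; rewrite (vanish _ _ cF).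
have BFP := affine_param_sub hF hP FP.
have sub : (BF + z <= BP)%MS by rewrite addsmx_sub BFP (affine_param_diff hP).
have rk : (\rank BP <= \rank (BF + z)%MS)%N.
  have rF : \rank BF = d by apply/eqP.
  rewrite (eqP fP) -[X in X.+1]rF.
  have : (BF < BF + z)%MS.
    by rewrite ltmxE addsmxSl /=; apply: contra zBF; apply: submx_trans (addsmxSr _ _).
  by rewrite ltmxErank => /andP[].
have BPs : (BP <= BF + z)%MS.
  by rewrite -(mxrank_leqif_sup sub) eqn_leq rk mxrankS.
clearbody z; exists (eval e z / eval c z) => x y Px Py.
have /sub_addsmxP[[u w] /= xy] : (x - y <= BF + z)%MS.
  exact: submx_trans (affine_param_diff hP Px Py) BPs.
have wz : w *m z = w 0 0 *: z.
  by rewrite [w in LHS]mx11_scalar mul_scalar_mx.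
rewrite -!evalB xy !evalD (vanish _ _ cF) (vanish _ _ eF) !add0r wz !evalZ.
by rewrite [RHS]mulrCA divfK.
Qed.

Lemma has_dim_inj P d d' : has_dim P d -> has_dim P d' -> d = d'.
Proof.
move=> [x [B [fB hB]]] [x' [B' [fB' hB']]].
have s := affine_param_sub hB hB' (@subset_refl _ P).
have s' := affine_param_sub hB' hB (@subset_refl _ P).
by rewrite -(eqP fB) -(eqP fB'); apply/eqP; rewrite eqn_leq !mxrankS.
Qed.

Lemma facet_nonconst P F d c b : has_dim P d.+1 -> has_dim F d ->
  F = [set x | P x /\ eval c x = b]%classic ->
  exists x y, [/\ P x, P y & eval c x != eval c y].
Proof.
move=> dP dF FE; have [x Fx] := has_dim_nonempty dF.
have [Px cx] : P x /\ eval c x = b by move: Fx; rewrite FE.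
apply: contrapT => hn; have PF : F = P.
  rewrite FE; apply/seteqP; split=> y; first by case.
  move=> Py; split=> //; rewrite -cx; apply/eqP; apply: contra_notT hn => yx.
  by exists y, x.
by rewrite PF in dF; have /eqP := has_dim_inj dP dF; rewrite eqn_leq ltnn.
Qed.

End Faces.

(** * Strict breaks and fold heights *)

Section Folds.
Variables (R : realType) (N : nat) (q : 'I_N -> 'rV[R]_2).
Hypothesis hq : convex_gon q.
Implicit Types (s u : {set 'I_N}) (i j k m a b p : 'I_N).
Implicit Types (t : {set {set 'I_N}}) (h : 'I_N -> R) (g l : 'rV[R]_2 -> R).
Local Notation D i j k := (orient (q i) (q j) (q k)).

Definition fold_height g a : R := Num.max (g (q a)) 0.

(** Suppose an edge [ab] of [t'] crosses [ij]. Planes over triangles of [t] and [t'] lie above all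
    lifted vertices, so at the crossing point the interpolations along [ij] and [ab] agree, and the
    planes [l], [l'] on both sides of [ij] pass through the lifted [a]. Sharing three noncollinear
    points they coincide, against the strict break. *)
Lemma strict_edge_uncrossed t t' h i j k m l : triangulation q t ->
  triangulation q t' -> locally_concave q t h -> locally_concave q t' h ->
  [set i; j; k] \in t -> [set i; j; m] \in t -> 0 < D i j k -> D i j m < 0 ->
  affine_fun l -> l (q i) = h i -> l (q j) = h j -> l (q k) = h k ->
  h m < l (q m) -> uncrossed q t' i j.
Proof.
move=> tt tt' tc tc' kt mt hk hm hl li lj lk lm u a b ut au bu ha.
rewrite leNgt; apply/negP => hb; have [t3' _ _] := tt'.
have [x [y [z [w [[x0 y0 z0 w0] xy zw e]]]]] := crossing hq hb ha.
have ab : a != b by apply: contraTneq hb => <-; rewrite -leNgt ltW.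
have [o [uE ao bo]] := cards3_sub (t3' _ ut) au bu ab.
have abo := orient_neq0 hq ab ao bo.
have abot : [set a; b; o] \in t' by rewrite -uE.
have [lu hlu [lua lub luo]] := affine_interp (h a) (h b) (h o) abo.
have [l' hl' [l'i l'j l'm]] := affine_interp (h i) (h j) (h m) (ltr0_neq0 hm).
have lui := locally_concave_above hq i tt' tc' abot abo hlu lua lub luo.
have luj := locally_concave_above hq j tt' tc' abot abo hlu lua lub luo.
(* At the crossing point [f] is the height along [ij], which is at most [lu], the height along [ab],
   which is at most [f]. As both weights are positive, [f] touches at [a]. *)
have touch f : affine_fun f -> f (q i) = h i -> f (q j) = h j ->
    h a <= f (q a) -> h b <= f (q b) -> f (q a) = h a.
  move=> hf fi fj fa fb; apply/eqP; rewrite eq_le fa andbT -subr_le0 -(pmulr_rle0 _ w0).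
  have e1 : z * f (q b) + w * f (q a) = x * h i + y * h j.
    by rewrite -fi -fj -!affine_comb2 // e.
  have e2 : z * h b + w * h a = x * lu (q i) + y * lu (q j).
    by rewrite -lua -lub -!affine_comb2 // e.
  have n1 : x * h i <= x * lu (q i) by rewrite ler_pM2l.
  have n2 : y * h j <= y * lu (q j) by rewrite ler_pM2l.
  have n3 : z * h b <= z * f (q b) by rewrite ler_pM2l.
  by rewrite mulrBr; lra.
have ijk := lt0r_neq0 hk; have ijm := ltr0_neq0 hm.
have la : l (q a) = h a.
  by apply: touch => //; apply: (locally_concave_above hq _ tt tc kt).
have l'a : l' (q a) = h a.
  by apply: touch => //; apply: (locally_concave_above hq _ tt tc mt).
have := affine_eq0 (affine_add hl (affine_opp hl')) (lt0r_neq0 ha).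
move=> /(_ _ _ _ (q m)); rewrite li lj la l'i l'j l'a l'm !subrr => /(_ erefl erefl erefl).
by move/eqP; rewrite subr_eq0 => /eqP lm'; rewrite lm' ltxx in lm.
Qed.

(** On triangles of the side the fold is [g]; on any other triangle [g] is negative somewhere, hence
    nowhere positive, and the fold is zero. *)
Lemma pairing_fold t g : triangulation q t -> one_sided q t g ->
  pairing q t (fold_height g) = side_pairing q t g (fun a => g (q a)).
Proof.
move=> tt gt; rewrite /pairing (bigID (in_side q g)) /= [X in _ + X]big1 ?addr0.
  apply: eq_bigr => s /andP[_ /forall_inP sg]; congr (_ * _).
  by apply: eq_bigr => a /sg ga; rewrite /fold_height max_l.
move=> s /andP[st]; rewrite negb_forall_in => /exists_inP[a as_]; rewrite -ltNge => ga.
rewrite /pairing_at big1 ?mulr0 // => b bs; rewrite /fold_height max_r // leNgt.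
by apply/negP => gb; have := gt s b a st bs as_ gb; rewrite leNgt ga.
Qed.

(** With the constant 1 in place of [g], the side is the whole polygon. *)
Lemma pairing_affine t t' l : triangulation q t -> triangulation q t' ->
  affine_fun l -> pairing q t (fun a => l (q a)) = pairing q t' (fun a => l (q a)).
Proof.
move=> tt tt' hl.
have E t0 : pairing q t0 (fun a => l (q a)) =
    side_pairing q t0 (fun=> 1) (fun a => l (q a)).
  apply: eq_bigl => s; rewrite [in_side _ _ _](_ : _ = true) ?andbT //.
  by apply/forall_inP.
rewrite !E; apply: side_pairing_const => //; first exact: affine_cst.
all: by move=> ? ? ? *; apply: ler01.
Qed.

Lemma pairingN t h : pairing q t (fun a => - h a) = - pairing q t h.
Proof.
by rewrite /pairing -sumrN; apply: eq_bigr => s _; rewrite /pairing_at sumrN mulrN.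
Qed.

Lemma pairing_lin t h h' (r r' : R) :
  pairing q t (fun a => r * h a + r' * h' a) = r * pairing q t h + r' * pairing q t h'.
Proof.
rewrite /pairing !mulr_sumr -big_split; apply: eq_bigr => s _.
by rewrite /pairing_at /= big_split /= -!mulr_sumr; ring.
Qed.

Lemma triangulation_triangle t : (0 < N)%N -> triangulation q t ->
  exists i j k, [set i; j; k] \in t /\ D i j k != 0.
Proof.
move=> N0 [t3 tU _]; have : polygon q (q (Ordinal N0)).
  by apply: sub_convex_hull; exists (Ordinal N0).
rewrite -tU => -[s /= st _]; have [i [j [k [sE ij ik jk]]]] := cards3P (t3 s st).
by exists i, j, k; rewrite -sE; split=> //; apply: orient_neq0.
Qed.

Lemma locally_affine t h : (0 < N)%N -> triangulation q t -> locally_concave q t h ->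
  locally_concave q t (fun a => - h a) ->
  exists2 l, affine_fun l & forall a, h a = l (q a).
Proof.
move=> N0 tt tc tc'; have [i [j [k [ijkt ijk]]]] := triangulation_triangle N0 tt.
have [l hl [li lj lk]] := affine_interp (h i) (h j) (h k) ijk.
exists l => // a; apply/eqP; rewrite eq_le.
rewrite (locally_concave_above hq a tt tc ijkt ijk hl li lj lk) /= -lerN2.
apply: (locally_concave_above hq a tt tc' ijkt ijk (affine_opp hl)).
all: by rewrite ?li ?lj ?lk.
Qed.

(** A constant pairing makes [t] a maximizer for both [h] and its negative. *)
Lemma pairing_const_affine t h : (0 < N)%N -> triangulation q t ->
  (forall t', triangulation q t' -> pairing q t' h = pairing q t h) ->
  exists2 l, affine_fun l & forall a, h a = l (q a).
Proof.
move=> N0 tt hc; apply: (locally_affine N0 tt).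
all: apply: maximizer_locally_concave => // t' tt'; rewrite ?pairingN hc //.
Qed.

Definition folding g :=
  [/\ affine_fun g, (exists i j, [/\ i != j, g (q i) = 0 & g (q j) = 0]),
      (exists k, 0 < g (q k)) & exists m, g (q m) < 0].

(* The four closed regions cut out by the lines g = 0 and g' = 0 contain at least
   N + 4 > 8 vertices in total, those on the lines being counted repeatedly. So
   some region contains three vertices. Flipping signs, both heights vanish there,
   hence so does the affine function they add up to, hence so do the heights. *)
Lemma folds_not_affine g g' l (r r' : R) : (4 < N)%N -> folding g -> folding g' ->
  0 < r -> 0 < r' -> affine_fun l ->
  (forall a, r * fold_height g a + r' * fold_height g' a = l (q a)) -> False.
Proof.
move=> N5 [hg [i [j [ij gi gj]]] [k gk] [m gm]] [hg' [i' [j' [ij' gi' gj']]] _ _] r0 r'0 hl E.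
pose region (e e' : bool) := [set a | (0 <= (-1) ^+ e * g (q a))
                                    & (0 <= (-1) ^+ e' * g' (q a))]%SET.
have [e [e' e3]] : exists e e', (2 < #|region e e'|)%N.
  apply: contrapT => hn.
  have le2 e e' : (#|region e e'| <= 2)%N.
    by rewrite leqNgt; apply/negP => h; apply: hn; exists e, e'.
  have big8 : (#|region true true| + #|region true false| + #|region false true|
     + #|region false false| <= 8)%N.
    by rewrite (leq_add (leq_add (leq_add (le2 _ _) (le2 _ _)) (le2 _ _)) (le2 _ _)).
  have two (f : 'rV[R]_2 -> R) a b : a != b -> f (q a) = 0 -> f (q b) = 0 ->
      (2 <= \sum_c (f (q c) == 0%R))%N.
    move=> ab fa fb; rewrite (bigD1 a) //= (bigD1 b) ?(eq_sym b) //= fa fb eqxx.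
    by rewrite addnA leq_addr.
  (* For each of the two lines through it, a vertex is counted at least once more, and each line
     contains two vertices. *)
  have : (N + 2 + 2 <= 8)%N.
    apply: leq_trans big8; rewrite -!sum1_card ![(\sum_(a in region _ _) _)%N]big_mkcond /=.
    apply: leq_trans (leq_add (leq_add (leqnn _) (two g i j ij gi gj))
      (two g' i' j' ij' gi' gj')) _.
    rewrite -[X in (X + _ + _)%N](card_ord N) -sum1_card -!big_split /=.
    apply: leq_sum => a _; rewrite !inE /= expr0 expr1 !mulN1r !mul1r !oppr_ge0.
    by case: (ltgtP (g (q a)) 0); case: (ltgtP (g' (q a)) 0).
  by rewrite -addnA leqNgt (leq_trans _ (leq_add N5 (leqnn 4))).
have /card_gt2P[a [b [c [[ar br cr] [ab bc ca]]]]] := e3.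
rewrite eq_sym in ca.
have abc := orient_neq0 hq ab ca bc.
(* Subtracting the affine pieces of both folds on the chosen region leaves a sum of two terms that
   are nonnegative at all vertices and zero on the region. *)
pose f x : R := l x - r * (~~ e)%:R * g x - r' * (~~ e')%:R * g' x.
have hf : affine_fun f.
  have [u [v [w lE]]] := hl; have [u1 [v1 [w1 gE]]] := hg; have [u2 [v2 [w2 g'E]]] := hg'.
  exists (u - r * (~~ e)%:R * u1 - r' * (~~ e')%:R * u2),
    (v - r * (~~ e)%:R * v1 - r' * (~~ e')%:R * v2),
    (w - r * (~~ e)%:R * w1 - r' * (~~ e')%:R * w2) => x.
  by rewrite /f lE gE g'E; ring.
have fE d : f (q d) = r * (fold_height g d - (~~ e)%:R * g (q d))
    + r' * (fold_height g' d - (~~ e')%:R * g' (q d)).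
  by rewrite /f -E; ring.
have part (o : bool) (y : R) : 0 <= (-1) ^+ o * y -> Num.max y 0 - (~~ o)%:R * y = 0.
  case: o; rewrite ?expr0 ?expr1 ?mulN1r ?mul1r ?oppr_ge0 /= => y0.
    by rewrite mul0r subr0 max_r.
  by rewrite max_l // subrr.
have fz d : d \in region e e' -> f (q d) = 0.
  by rewrite inE => /andP[ge ge']; rewrite fE /fold_height !part // !mulr0 addr0.
have f0 := affine_eq0 hf abc (fz a ar) (fz b br) (fz c cr).
have ge0 (o : bool) (y : R) : 0 <= Num.max y 0 - (~~ o)%:R * y.
  by case: o; rewrite /= ?mul0r ?mul1r subr_ge0 le_max lexx ?orbT.
have gz d : fold_height g d - (~~ e)%:R * g (q d) = 0.
  have := f0 (q d); rewrite fE => /eqP.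
  rewrite paddr_eq0 ?mulr_ge0 ?ge0 ?(ltW r0) ?(ltW r'0) // => /andP[/eqP + _].
  by move/eqP; rewrite mulf_eq0 (negPf (lt0r_neq0 r0)) => /eqP.
have := gz k; have := gz m; rewrite /fold_height (max_l (ltW gk)) (max_r (ltW gm)).
by case: (e) => /=; lra.
Qed.

End Folds.

(** * Facets of the secondary polytope *)

Section SecondaryPolytope.
Variables (R : realType) (N : nat) (q : 'I_N -> 'rV[R]_2).
Hypothesis hq : convex_gon q.
Hypothesis N5 : (4 < N)%N.
Implicit Types (t : {set {set 'I_N}}) (h : 'I_N -> R).
Implicit Types (F G : set 'rV[R]_N) (c : 'cV[R]_N).
Local Notation D i j k := (orient (q i) (q j) (q k)).

Definition height_col h : 'cV[R]_N := \col_i h i.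

Lemma eval_gkz t h : eval (height_col h) (gkz_vector q t) = pairing q t h.
Proof.
rewrite /eval gkz_pairing /pairing; apply: eq_bigr => s _; congr (_ * _).
by apply: eq_bigr => i _; rewrite mxE.
Qed.

Lemma eval_gkz_col t c : eval c (gkz_vector q t) = pairing q t (fun i => c i 0).
Proof. exact: gkz_pairing. Qed.

Lemma gkz_secondary t : triangulation q t -> secondary_polytope q (gkz_vector q t).
Proof. by move=> tt; apply: sub_convex_hull; exists t. Qed.

Lemma facet_fold F c b d : has_dim (secondary_polytope q) d.+1 -> has_dim F d ->
  (forall x, secondary_polytope q x -> eval c x <= b) ->
  F = [set x | secondary_polytope q x /\ eval c x = b]%classic ->
  exists g nu, [/\ folding q g, 0 < nu &
    forall t t', triangulation q t -> triangulation q t' ->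
      eval c (gkz_vector q t) - eval c (gkz_vector q t') =
      - nu * (pairing q t (fold_height q g) - pairing q t' (fold_height q g))].
Proof.
move=> dP dF cb FE; have nc := facet_nonconst dP dF FE.
pose h i := c i 0.
have N0 : (0 < N)%N by apply: leq_trans N5.
have cbv v : [set gkz_vector q t | t in triangulation q]%classic v -> eval c v <= b.
  by move=> Vv; apply/cb/sub_convex_hull.
have [x0 Fx0] := has_dim_nonempty dF.
have [Px0 cx0] : secondary_polytope q x0 /\ eval c x0 = b by move: Fx0; rewrite FE.
have [_ [t tt <-] ct] := convex_face_vertex cbv Px0 cx0.
have top t0 : triangulation q t0 -> eval c (gkz_vector q t0) = b -> locally_concave q t0 h.
  move=> tt0 ct0; apply: maximizer_locally_concave => // t' tt'.
  by rewrite -!eval_gkz_col ct0; apply/cb/gkz_secondary.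
have tc := top t tt ct.
have [i [j [k [m [l [kt mt hk [hm hl [li lj lk] lm]]]]]]] :
    exists i j k m l, [/\ [set i; j; k] \in t, [set i; j; m] \in t, 0 < D i j k &
      [/\ D i j m < 0, affine_fun l, [/\ l (q i) = h i, l (q j) = h j & l (q k) = h k]
        & h m < l (q m)]].
  (* Without a strict break the negated height is locally concave too, so [h] is affine and [c] is
     constant on the polytope, against [nc]. *)
  apply: contrapT => hn.
  have tc' : locally_concave q t (fun a => - h a).
    move=> i j k m l kt mt hk hm hl li lj lk; rewrite leNgt; apply/negP => lm.
    apply: hn; exists i, j, k, m, (fun x => - l x); split=> //; split=> //.
    - exact: affine_opp.
    - by rewrite li lj lk !opprK.
    - by rewrite ltrNr.
  have [l hl hE] := locally_affine hq N0 tt tc tc'.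
  have constV v : [set gkz_vector q t | t in triangulation q]%classic v ->
      eval c v = eval c (gkz_vector q t).
    move=> [t' tt' <-]; rewrite !eval_gkz_col.
    have -> : (fun i => c i 0) = (fun a => l (q a)) by apply: funext => a; rewrite -hE.
    exact: pairing_affine.
  have const x : secondary_polytope q x -> eval c x = eval c (gkz_vector q t).
    by move=> Px; apply: (eval_affine_hull constV); case: Px => n [p [r [? _ ? ?]]]; exists n, p, r.
  by case: nc => x [y [Px Py]]; rewrite !const // eqxx.
have ij_t' t' : triangulation q t' -> eval c (gkz_vector q t') = b -> uncrossed q t' i j.
  move=> tt' ct'; exact: (strict_edge_uncrossed hq tt tt' tc (top t' tt' ct') kt mt hk hm hl).
pose g := orient (q i) (q j); have hg : affine_fun g by exact: affine_orient.
pose f := fold_height q g.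
have constF x : F x -> eval (height_col f) x = pairing q t f.
  rewrite FE => -[Px cx]; apply: (eval_convex_face cbv _ Px cx) => _ [t' tt' <-] ct'.
  rewrite eval_gkz !pairing_fold //; [|exact: ij_t'..].
  by apply: side_pairing_const => //; apply: ij_t'.
have [r rE] : exists r, forall x y, secondary_polytope q x -> secondary_polytope q y ->
    eval (height_col f) x - eval (height_col f) y = r * (eval c x - eval c y).
  by apply: (facet_functional (b := b) dP dF _ _ constF nc) => x; rewrite FE => -[].
have ft := flip_triangulation hq tt kt mt hk hm.
have dc := pairing_flip hq tt kt mt hk hm hl li lj lk.
have [ij ik jk] := orient_neq (lt0r_neq0 hk).
have gi : g (q i) = f i by rewrite /f /fold_height /g orient_aba max_r.
have gj : g (q j) = f j by rewrite /f /fold_height /g orient_abb max_r.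
have gk : g (q k) = f k by rewrite /f /fold_height /g max_l // ltW.
have df := pairing_flip hq tt kt mt hk hm hg gi gj gk.
(* The flip at [ij] lowers [c], as the break is strict, but raises the pairing with the fold, whose
   value 0 at [m] exceeds [g (q m)]. *)
have r0 : r < 0.
  have := rE _ _ (gkz_secondary ft) (gkz_secondary tt).
  rewrite !eval_gkz !eval_gkz_col dc df => e.
  have hk2 : 0 < D i j k / 2 by rewrite divr_gt0.
  have n1 : D i j k / 2 * (h m - l (q m)) < 0 by rewrite pmulr_rlt0 // subr_lt0.
  rewrite -(nmulr_lgt0 _ n1) -e pmulr_rgt0 // /f /fold_height (max_r (ltW hm)) /g.
  by rewrite sub0r oppr_gt0.
(* Differences of the fold pairing are [r] times those of [c], which is solved for [c]. *)
exists g, (- r^-1); split.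
- split=> //; first by exists i, j; rewrite /g orient_aba orient_abb.
    by exists k.
  by exists m.
- by rewrite oppr_gt0 invr_lt0.
- move=> t1 t2 tt1 tt2; rewrite opprK -!eval_gkz rE; try exact: gkz_secondary.
  by rewrite mulrA mulVf ?mul1r // ltr0_neq0.
Qed.

Lemma secondary_no_parallel_facets F G : ~ parallel_facets (secondary_polytope q) F G.
Proof.
move=> [[[c [b [cb FE]]] [d [dP dF]]] [[c' [b' [cb' GE]]] [d' [dP' dG]]] FG [w par]].
have nc := facet_nonconst dP dF FE; have nc' := facet_nonconst dP' dG GE.
have cF x : F x -> eval c x = b by rewrite FE => -[].
have cG x : G x -> eval c' x = b' by rewrite GE => -[].
have FP : (F `<=` secondary_polytope q)%classic by rewrite FE => x [].
(* Translation by [w] takes [F] into the affine hull of [G], where [c'] is constant. *)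
have c'F x : F x -> eval c' x = b' - eval c' w.
  move=> Fx; rewrite -(eval_affine_hull cG (x := x + w)) ?evalD ?addrK //.
  by rewrite par; exists x => //; apply: sub_affine_hull.
have [r rE] := facet_functional dP dF FP cF c'F nc.
have [x0 Fx0] := has_dim_nonempty dF; have [y0 Gy0] := has_dim_nonempty dG.
have Px0 := FP _ Fx0; have Py0 : secondary_polytope q y0 by move: Gy0; rewrite GE => -[].
have r0 : r != 0.
  case: nc' => x [y [Px Py]]; apply: contra => /eqP r0.
  by rewrite -subr_eq0 rE // r0 mul0r.
(* For [r > 0] both functionals are maximal at the same points, so that [F = G]. *)
have [rpos|rneg] := ltP 0 r.
  have b'x0 : eval c' x0 = b'.
    apply/eqP; rewrite eq_le cb' //= -(cG _ Gy0) -subr_ge0 rE // pmulr_rge0 // subr_ge0.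
    by rewrite (cF _ Fx0) cb.
  apply: FG; rewrite FE GE; apply/seteqP; split=> x /= [Px cx]; split=> //.
    have {}cx : eval c x = b := cx.
    have /eqP := rE x x0 Px Px0; rewrite cx (cF _ Fx0) subrr mulr0 subr_eq0 b'x0.
    by move=> /eqP.
  have {}cx : eval c' x = b' := cx.
  have /esym/eqP := rE x x0 Px Px0; rewrite cx b'x0 subrr mulf_eq0.
  by rewrite (negPf r0) /= subr_eq0 (cF _ Fx0) => /eqP.
have {}r0 : r < 0 by rewrite lt_neqAle r0.
have [g [nu [gf nu0 gE]]] := facet_fold dP dF cb FE.
have [g' [nu' [gf' nu'0 gE']]] := facet_fold dP' dG cb' GE.
have N0 : (0 < N)%N by apply: leq_trans N5.
have [t tt] : exists t, triangulation q t.
  case: Px0 => -[|n] [p [s [pV _ s1 _]]].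
    by move: s1; rewrite big_ord0 => /esym/eqP; rewrite oner_eq0.
  by have [t tt _] := pV ord0; exists t.
pose f := fold_height q g; pose f' := fold_height q g'.
(* Differences of [c'] are [r] times those of [c], so by [facet_fold] this combination has a
   constant pairing; its coefficients are positive because [r < 0]. *)
have [l hl lE] : exists2 l, affine_fun l &
    forall a, - r * nu * f a + nu' * f' a = l (q a).
  apply: (pairing_const_affine hq N0 tt) => t' tt'; rewrite !pairing_lin.
  have := rE _ _ (gkz_secondary tt') (gkz_secondary tt).
  by rewrite gE // gE' // -/f -/f'; lra.
apply: (folds_not_affine hq N5 gf gf' _ nu'0 hl lE).
by rewrite mulr_gt0 // oppr_gt0.
Qed.

End SecondaryPolytope.

Theorem proposition3p5 (R : realType) (n : nat) (q : 'I_(n + 3) -> 'rV[R]_2) :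
  (2 <= n)%N -> convex_gon q ->
  ~ exists F G : set 'rV[R]_(n + 3),
      parallel_facets (secondary_polytope q) F G.
Proof.
move=> n2 hq [F [G]]; apply: (secondary_no_parallel_facets hq).
by rewrite addn3.
Qed.
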